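(* Let $\ell\ge 1$ be any integer. Then $$2\, d_{\mathrm{GH}}(S^1, S^{2\ell}) = 2\, d_{\mathrm{GH}}(S^1, S^{2\ell+1}) = \frac{2\pi \ell}{2\ell+1},$$ or equivalently $$\pi - 2\, d_{\mathrm{GH}}(S^1, S^{2\ell}) = \pi - 2\, d_{\mathrm{GH}}(S^1, S^{2\ell+1}) = \frac{\pi}{2\ell+1}.$$
   Context: For an integer $n\ge 1$, $S^n=\{x\in\mathbb{R}^{n+1} : \langle x,x\rangle=1\}$ is the unit sphere equipped with the geodesic metric $d_{S^n}(x,x')=\arccos(\langle x,x'\rangle)$. A correspondence between sets $X$ and $Y$ is a relation $R\subseteq X\times Y$ whose coordinate projections to $X$ and to $Y$ are both surjective. For metric spaces $(X,d_X)$, $(Y,d_Y)$, the distortion of $R$ is $\operatorname{dis}(R)=\sup_{(x,y),(x',y')\in R}|d_X(x,x')-d_Y(y,y')|$. The Gromov--Hausdorff distance between compact metric spaces $X,Y$ is given by $2\,d_{\mathrm{GH}}(X,Y)=\inf_R \operatorname{dis}(R)$, the infimum being over all correspondences $R\subseteq X\times Y$. *)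

(* Defs.v *)
From HB Require Import structures.
From mathcomp Require Import all_boot all_order all_algebra.
From mathcomp Require Import all_classical all_reals all_analysis.
From mathcomp Require Import ring lra.

Set Implicit Arguments.
Unset Strict Implicit.
Unset Printing Implicit Defensive.

Import Order.TTheory GRing.Theory Num.Theory.
Import numFieldNormedType.Exports.

Local Open Scope classical_set_scope.
Local Open Scope ring_scope.

Section Dot.
Context {R : realType} {m : nat}.
Implicit Types u v w : 'rV[R]_m.

Definition dot u v : R := \sum_(i < m) u 0 i * v 0 i.

Lemma dotC u v : dot u v = dot v u.
Proof. by apply: eq_bigr => i _; rewrite mulrC. Qed.

Lemma dotBl u v w : dot (u - v) w = dot u w - dot v w.
Proof. by rewrite -sumrB; apply: eq_bigr => i _; rewrite !mxE mulrBl. Qed.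

Lemma dotBr u v w : dot u (v - w) = dot u v - dot u w.
Proof. by rewrite !(dotC u) dotBl. Qed.

Lemma dotZl a u v : dot (a *: u) v = a * dot u v.
Proof. by rewrite big_distrr; apply: eq_bigr => i _; rewrite mxE /= mulrA. Qed.

Lemma dotZr a u v : dot u (a *: v) = a * dot u v.
Proof. by rewrite !(dotC u) dotZl. Qed.

Lemma dot_ge0 u : 0 <= dot u u.
Proof. by apply: sumr_ge0 => i _; rewrite -expr2 sqr_ge0. Qed.

Lemma dot_eq0 u : dot u u = 0 -> u = 0.
Proof.
move=> /eqP; rewrite psumr_eq0; last by move=> i _; rewrite -expr2 sqr_ge0.
move=> /allP u0; apply/rowP => i; rewrite mxE; apply/eqP.
by have := u0 i (mem_index_enum _); rewrite /= mulf_eq0 orbb.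
Qed.

Lemma dot_CauchySchwarz u v : dot u v ^+ 2 <= dot u u * dot v v.
Proof.
have [v0|v_neq0] := eqVneq (dot v v) 0.
  have -> : dot u v = 0.
    by rewrite (dot_eq0 v0); apply: big1 => i _; rewrite mxE mulr0.
  by rewrite expr0n /= v0 mulr0.
have v_gt0 : 0 < dot v v by rewrite lt_neqAle eq_sym v_neq0 dot_ge0.
have := dot_ge0 (dot v v *: u - dot u v *: v).
rewrite !(dotBl, dotBr, dotZl, dotZr) (dotC v u) => h.
rewrite -subr_ge0 -(pmulr_rge0 _ v_gt0); apply: le_trans h _.
by rewrite le_eqVlt; apply/orP; left; apply/eqP; ring.
Qed.

End Dot.

(** [sphere R n] is S^n, the unit sphere of R^(n+1). *)
Record sphere (R : realType) (n : nat) := Sphere {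
  sphere_val :> 'rV[R]_n.+1;
  _ : dot sphere_val sphere_val == 1
}.

HB.instance Definition _ R n := [isSub for @sphere_val R n].
HB.instance Definition _ R n := [Choice of sphere R n by <:].

Definition geodesic_dist (R : realType) (n : nat) (x y : sphere R n) : R :=
  acos (dot x y).

Section SphereMetric.
Context {R : realType} {n : nat}.
Implicit Types x y z : sphere R n.

Lemma sphere_dot x : dot x x = 1.
Proof. by apply/eqP; case: x. Qed.

Lemma sphere_dot_itv x y : -1 <= dot x y <= 1.
Proof.
have := dot_CauchySchwarz x y; rewrite !sphere_dot mulr1 => h.
by rewrite -ler_norml -(@expr_le1 _ 2) // real_normK ?num_real.
Qed.

Lemma geodesic_distxx x : geodesic_dist x x = 0.
Proof. by rewrite /geodesic_dist sphere_dot acos1. Qed.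

Lemma geodesic_dist_positivity x y : geodesic_dist x y = 0 -> x = y.
Proof.
move=> /(congr1 (@cos R)); rewrite cos0 acosK ?in_itv /= ?sphere_dot_itv //.
move=> xy; apply/val_inj/eqP; rewrite -subr_eq0; apply/eqP/dot_eq0.
by rewrite !(dotBl, dotBr) (dotC (val y)) !sphere_dot xy; ring.
Qed.

Lemma geodesic_dist_sym x y : geodesic_dist x y = geodesic_dist y x.
Proof. by rewrite /geodesic_dist dotC. Qed.

Lemma geodesic_dist_triangle y x z :
  geodesic_dist x z <= geodesic_dist x y + geodesic_dist y z.
Proof.
rewrite /geodesic_dist.
have [xy yz xz] := And3 (sphere_dot_itv x y) (sphere_dot_itv y z)
  (sphere_dot_itv x z).
set a := acos (dot x y); set b := acos (dot y z).
have [a0 b0] : 0 <= a /\ 0 <= b by split; exact: acos_ge0.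
have [piab|abpi] := leP pi (a + b).
  by rewrite (le_trans _ piab) // acos_lepi.
rewrite leNgt -ltr_cos ?in_itv /= ?acos_ge0 ?acos_lepi ?addr_ge0 ?(ltW abpi) //.
rewrite -leNgt cosD !acosK ?in_itv //=.
have [sa sb] : 0 <= sin a /\ 0 <= sin b.
  by split; apply: sin_ge0_pi; rewrite ?acos_ge0 ?acos_lepi.
have sin2 (c : R) : -1 <= c <= 1 -> sin (acos c) ^+ 2 = 1 - c ^+ 2.
  by move=> c1; rewrite sin2cos2 acosK ?in_itv.
have CS : (dot x z - dot x y * dot y z) ^+ 2 <= (sin a * sin b) ^+ 2.
  have := dot_CauchySchwarz (val x - dot x y *: val y)
    (val z - dot y z *: val y).
  rewrite !(dotBl, dotBr, dotZl, dotZr) !sphere_dot.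
  rewrite (dotC (val y) (val x)) (dotC (val z) (val y)) exprMn !sin2 //.
  by congr (_ <= _); rewrite /=; ring.
have sab := mulr_ge0 sa sb.
move: CS; rewrite -real_normK ?num_real // ler_pXn2r ?nnegrE //.
rewrite ler_norml => /andP[h _].
by lra.
Qed.

End SphereMetric.

HB.instance Definition _ (R : realType) (n : nat) :=
  @isMetric.Build R (sphere R n) (@geodesic_dist R n)
    geodesic_distxx geodesic_dist_positivity
    geodesic_dist_sym geodesic_dist_triangle.

Lemma sphere_mdistE (R : realType) (n : nat) (x y : sphere R n) :
  mdist x y = acos (dot x y).
Proof. by []. Qed.

Section GromovHausdorff.
Context {R : realType} (X Y : metricType R).
Local Open Scope ereal_scope.

Definition correspondence (r : set (X * Y)) : Prop :=
  [set p.1 | p in r] = [set: X] /\ [set p.2 | p in r] = [set: Y].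

Definition distortion (r : set (X * Y)) : \bar R :=
  ereal_sup [set (`|mdist p.1 q.1 - mdist p.2 q.2|)%R%:E | p in r & q in r].

(** Values in [\bar R], so that no boundedness side condition is hidden in the
    supremum and infimum; on nonempty compact spaces the value is finite. *)
Definition gromov_hausdorff : \bar R :=
  (2^-1)%R%:E * ereal_inf [set distortion r | r in correspondence].

End GromovHausdorff.

(* Main.v *)
Require Import Defs.
From mathcomp Require Import all_boot all_order all_algebra.
From mathcomp Require Import all_classical all_reals all_analysis.
From mathcomp Require Import ring lra zify.

(** Put m = 2l+1.

    Upper bound, for n = 2l and n = 2l+1. A point x of S^n is read as the
    trigonometric polynomial p_x(t) = <x, u(t)> with the odd frequencies
    1, 3, .., m, and x is related to every point e^{it} of the circle at which
    p_x attains its maximum. This relation is invariant under the antipodal maps,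
    so it is enough to bound d(e^{it}, e^{it'}) by d(x, y) + pi - pi/m. If t' is
    at distance s < pi/m from t + pi, then p_x is maximal at t and p_y is
    minimal at t + s, say. By M. Riesz's inequality (near its maximum a polynomial of
    degree m dominates the cosine of frequency m) p_x - p_y is at least
    (max p_x + max (-p_y)) cos(ms/2) at the midpoint t + s/2, where both maxima
    are at least 1/sqrt 2 by Parseval, while it is at most sqrt(l+1) |x - y|
    there by Cauchy-Schwarz. This forces d(x, y) >= pi/m - s.

    Lower bound, for n >= 2l. A correspondence of distortion d < pi - pi/m
    yields an odd map from S^n to S^1 of distortion at most d. Write its values as
    +e^{it} or -e^{it} with 0 <= t < pi, and use t and the sign as the label of a
    point. Ky Fan's lemma on a fine antipodal mod 2 chain of dimension 2l gives m
    points close to each other whose signs alternate when sorted by t. Consecutive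
    t's then differ by almost pi - d or more, but the first and the last one, having the
    same sign, by at most about d: hence 2l (pi - d) <= d, a contradiction. *)

Set Implicit Arguments.
Unset Strict Implicit.
Unset Printing Implicit Defensive.

Import Order.TTheory GRing.Theory Num.Theory.
Import numFieldNormedType.Exports.

Local Open Scope ring_scope.

(** * Trigonometric sums and interpolation *)

Section Trigonometry.
Context {R : realType}.
Implicit Types a b c x y : R.

Lemma cosD_natpi n a : cos (a + n%:R * pi) = (-1) ^+ n * cos a.
Proof. by rewrite mulrC mulr_natr (alternatingn (@cosDpi R)). Qed.

Lemma sinD_natpi n a : sin (a + n%:R * pi) = (-1) ^+ n * sin a.
Proof. by rewrite mulrC mulr_natr (alternatingn (@sinDpi R)). Qed.

Lemma sinB_natpi n a : sin (a - n%:R * pi) = (-1) ^+ n * sin a.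
Proof.
by rewrite -[in RHS](subrK (n%:R * pi) a) sinD_natpi mulrA -expr2 sqrr_sign mul1r.
Qed.

Lemma sum_cos_arith n c x :
  2 * sin x * (\sum_(j < n) cos (c + 2 * j%:R * x)) =
  sin (c + (2 * n%:R - 1) * x) - sin (c - x).
Proof.
elim: n => [|n IHn]; first by rewrite big_ord0 !mulr0 sub0r mulN1r subrr.
rewrite big_ord_recr /= mulrDr IHn.
have -> : c + (2 * n.+1%:R - 1) * x = (c + 2 * n%:R * x) + x by ring.
have -> : c + (2 * n%:R - 1) * x = (c + 2 * n%:R * x) - x by ring.
set y := c + _ * x; rewrite -addrA addrCA (sinD y x) (sinB y x); ring.
Qed.

(** The closed form is a difference of two sines whose arguments differ by [2 g pi], and [0 < g < n]
    makes the factor [sin x] nonzero. *)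
Lemma sum_cos_roots n g c : (0 < g < n)%N ->
  \sum_(j < n) cos (c + 2 * j%:R * (g%:R * pi / n%:R)) = 0.
Proof.
move=> /andP[g0 gn]; have n0 : (0 : R) < n%:R by rewrite ltr0n; lia.
set x := g%:R * pi / n%:R.
have sx : 0 < sin x.
  apply: sin_gt0_pi; apply/andP; split.
    by rewrite divr_gt0 // mulr_gt0 ?ltr0n // pi_gt0.
  by rewrite ltr_pdivrMr // mulrC ltr_pM2l ?pi_gt0 // ltr_nat.
have sx0 : 2 * sin x != 0 by rewrite mulf_neq0 ?(gt_eqF sx).
apply: (mulfI sx0).
rewrite sum_cos_arith mulr0.
have -> : c + (2 * n%:R - 1) * x = c - x + (2 * g)%:R * pi.
  by rewrite /x natrM; field; rewrite gt_eqF.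
by rewrite sinD_natpi exprM sqrrN expr1n expr1n mul1r subrr.
Qed.

(** The Dirichlet kernel of degree [l] at [2 x]. The cosine sum, unlike a quotient of sines, makes
    sense at the zeros of [sin x]. *)
Definition dirichlet (l : nat) x : R :=
  1 + 2 * \sum_(k < l) cos (2 * k.+1%:R * x).

Lemma dirichletE l x : sin x * dirichlet l x = sin ((2 * l).+1%:R * x).
Proof.
have := sum_cos_arith l (2 * x) x.
under eq_bigr => k _.
  have -> : 2 * x + 2 * k%:R * x = 2 * k.+1%:R * x by ring.
  over.
have -> : 2 * x + (2 * l%:R - 1) * x = (2 * l).+1%:R * x.
  by ring.
have -> : 2 * x - x = x by ring.
by rewrite /dirichlet => h; rewrite -[RHS](subrK (sin x)) -h; ring.
Qed.

Lemma dirichlet_sum l a :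
  \sum_(j < (2 * l).+1) dirichlet l (a - j%:R * (pi / (2 * l).+1%:R)) =
  (2 * l).+1%:R.
Proof.
rewrite big_split /= sumr_const card_ord -[RHS]addr0; congr (_ + _).
rewrite -big_distrr /= exchange_big /= big1 ?mulr0 // => k _.
have kl := ltn_ord k.
rewrite -[RHS](@sum_cos_roots (2 * l).+1 k.+1 (- (2 * k.+1%:R * a))); last by lia.
by apply: eq_bigr => j _; rewrite -cosN; congr cos; ring.
Qed.

(** Induction on [e]: replacing [c] by [c + 2 a] makes the right-hand sides of two consecutive
    identities equal. By [dirichletE], the difference of their left-hand sides is a multiple of a
    sum that [sum_cos_roots] annihilates, its frequency [e + l + 1] being below [2 l + 1]. *)
Lemma dirichlet_interpolation l e a c : (e <= l)%N ->
  let t := pi / (2 * l).+1%:R in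
  \sum_(j < (2 * l).+1)
     dirichlet l (a - j%:R * t) * sin ((2 * e)%:R * (j%:R * t) + c) =
  (2 * l).+1%:R * sin ((2 * e)%:R * a + c).
Proof.
move=> + t; elim: e c => [|e IHe] c el.
  under eq_bigr do rewrite mul0r.
  by rewrite -big_distrl /= dirichlet_sum mul0r.
have -> : (2 * e.+1)%:R * a + c = (2 * e)%:R * a + (c + 2 * a).
  by ring.
rewrite -IHe 1?ltnW //; apply/eqP; rewrite -subr_eq0 -sumrB; apply/eqP.
have t0 : (2 * l).+1%:R * t = pi by rewrite mulrC divfK // pnatr_eq0.
pose b := c + 2 * a - a.
transitivity (- 2 * sin ((2 * l).+1%:R * a) *
  \sum_(j < (2 * l).+1) cos (b + 2 * j%:R * ((e + l).+1%:R * pi / (2 * l).+1%:R))).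
  rewrite big_distrr; apply: eq_bigr => j _ /=.
  set y := a - j%:R * t.
  have -> : (2 * e.+1)%:R * (j%:R * t) + c =
      ((2 * e).+1%:R * (j%:R * t) + b) - y.
    by rewrite /y /b; ring.
  have -> : (2 * e)%:R * (j%:R * t) + (c + 2 * a) =
      ((2 * e).+1%:R * (j%:R * t) + b) + y.
    by rewrite /y /b; ring.
  have -> : b + 2 * j%:R * ((e + l).+1%:R * pi / (2 * l).+1%:R) =
      (2 * e).+1%:R * (j%:R * t) + b + j%:R * pi.
    by rewrite -[in RHS]t0 -(mulrA _ pi) -/t; ring.
  set z := (2 * e).+1%:R * (j%:R * t) + b.
  rewrite cosD_natpi (sinB z y) (sinD z y).
  have := dirichletE l y.
  have -> : sin ((2 * l).+1%:R * y) = (-1) ^+ j * sin ((2 * l).+1%:R * a).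
    rewrite -sinB_natpi; congr sin.
    by rewrite /y mulrBr -[in RHS]t0; ring.
  move=> h; rewrite [LHS](_ : _ = -2 * cos z * (sin y * dirichlet l y)); last by ring.
  by rewrite h; ring.
rewrite sum_cos_roots ?mulr0 //; lia.
Qed.


Definition riesz_weight (l : nat) a x : R :=
  sin a * sin ((2 * l).+1%:R * a) / (sin x * sin (x - a)).

(* Hermite interpolation of a term of odd frequency at the nodes [j pi / m], with the
   node 0 doubled: the coefficient of [sin (m a)] comes from the derivative at 0. The
   proof goes from frequency [m] downwards; the difference of two consecutive
   identities is [dirichlet_interpolation]. *)
Lemma riesz_interpolation l k a c : (k <= l)%N ->
  let m := (2 * l).+1 in
  0 < a < pi / m%:R ->
  m%:R * (cos ((2 * k).+1%:R * a + c) - cos c * cos (m%:R * a)) +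
    (2 * k).+1%:R * sin c * sin (m%:R * a) =
  \sum_(j < 2 * l) (-1) ^+ j * riesz_weight l a (j.+1%:R * (pi / m%:R)) *
    (cos ((2 * k).+1%:R * (j.+1%:R * (pi / m%:R)) + c) + (-1) ^+ j * cos c).
Proof.
move=> kl m /andP[a0 am]; set t := pi / m%:R.
have m0 : (0 : R) < m%:R by rewrite ltr0n.
have t0 : 0 < t by rewrite divr_gt0 ?pi_gt0.
have mt : m%:R * t = pi by rewrite mulrC divfK ?gt_eqF.
have tj (j : 'I_(2 * l)) : j.+1%:R * t < pi.
  by rewrite -mt ltr_pM2r // ltr_nat ltnS ltn_ord.
have st (j : 'I_(2 * l)) : sin (j.+1%:R * t) != 0.
  by rewrite gt_eqF // sin_gt0_pi // tj andbT mulr_gt0.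
have ta (j : 'I_(2 * l)) : t <= j.+1%:R * t by rewrite ler_peMl ?(ltW t0) ?ler1n.
have sta (j : 'I_(2 * l)) : sin (j.+1%:R * t - a) != 0.
  rewrite gt_eqF // sin_gt0_pi // subr_gt0 (lt_le_trans am (ta j)) /=.
  by have := tj j; lra.
pose E k := m%:R * (cos ((2 * k).+1%:R * a + c) - cos c * cos (m%:R * a)) +
    (2 * k).+1%:R * sin c * sin (m%:R * a) -
  \sum_(j < 2 * l) (-1) ^+ j * riesz_weight l a (j.+1%:R * t) *
    (cos ((2 * k).+1%:R * (j.+1%:R * t) + c) + (-1) ^+ j * cos c).
suff: E k = 0 by move/subr0_eq.
(* At frequency [m] every bracket of the sum cancels, since [m] times a node is a multiple of
   [pi]. *)
have El : E l = 0.
  rewrite /E -/m big1 ?subr0 => [|j _]; first by rewrite (cosD (_ * a)); ring.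
  have -> : m%:R * (j.+1%:R * t) + c = c + j.+1%:R * pi by rewrite -mt; ring.
  by rewrite cosD_natpi exprS; ring.
rewrite -(subKn kl); elim: (l - k)%N (leq_subr k l) => [|d IHd] dl.
  by rewrite subn0.
rewrite -(IHd (ltnW dl)).
have -> : (l - d = (l - d.+1).+1)%N by lia.
set e := (l - d.+1)%N.
have el : (e.+1 <= l)%N by rewrite /e; lia.
apply/eqP; rewrite -subr_eq0; apply/eqP.
(* The node 0 is split off; its term yields, through [dirichletE], the multiple of [sin (m a)]. *)
have := dirichlet_interpolation a c el.
rewrite /= big_ord_recl -/m -/t /= mul0r subr0 mulr0 add0r => D.
transitivity (2 * sin a * (m%:R * sin ((2 * e.+1)%:R * a + c) -
  (dirichlet l a * sin c + \sum_(i < 2 * l) dirichlet l (a - i.+1%:R * t) *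
      sin ((2 * e.+1)%:R * (i.+1%:R * t) + c)))); last first.
  by rewrite -D subrr mulr0.
have DL := dirichletE l a; rewrite -/m in DL.
have stepC x : cos ((2 * e).+1%:R * x + c) - cos ((2 * e.+1).+1%:R * x + c) =
    2 * sin ((2 * e.+1)%:R * x + c) * sin x.
  set z := (2 * e.+1)%:R * x + c.
  have -> : (2 * e).+1%:R * x + c = z - x by rewrite /z; ring.
  have -> : (2 * e.+1).+1%:R * x + c = z + x by rewrite /z; ring.
  by rewrite (cosB z x) (cosD z x); ring.
transitivity (m%:R * (cos ((2 * e).+1%:R * a + c) - cos ((2 * e.+1).+1%:R * a + c))
  - 2 * sin c * sin (m%:R * a) -
  \sum_(j < 2 * l) (-1) ^+ j * riesz_weight l a (j.+1%:R * t) *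
    (cos ((2 * e).+1%:R * (j.+1%:R * t) + c) -
     cos ((2 * e.+1).+1%:R * (j.+1%:R * t) + c))).
  rewrite /E; under [in RHS]eq_bigr => j _.
    rewrite (_ : _ - _ = (cos ((2 * e).+1%:R * (j.+1%:R * t) + c) + (-1) ^+ j * cos c)
     - (cos ((2 * e.+1).+1%:R * (j.+1%:R * t) + c) + (-1) ^+ j * cos c)); last by ring.
    rewrite mulrBr.
    over.
  by rewrite sumrB; ring.
rewrite stepC -DL.
have -> : \sum_(j < 2 * l) (-1) ^+ j * riesz_weight l a (j.+1%:R * t) *
    (cos ((2 * e).+1%:R * (j.+1%:R * t) + c) -
     cos ((2 * e.+1).+1%:R * (j.+1%:R * t) + c)) =
   2 * sin a * \sum_(i < 2 * l) dirichlet l (a - i.+1%:R * t) *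
      sin ((2 * e.+1)%:R * (i.+1%:R * t) + c).
  rewrite big_distrr; apply: eq_bigr => j _ /=; rewrite stepC.
  have : sin (j.+1%:R * t - a) * dirichlet l (a - j.+1%:R * t) =
      (-1) ^+ j * sin (m%:R * a).
    have := dirichletE l (a - j.+1%:R * t); rewrite -/m.
    have -> : m%:R * (a - j.+1%:R * t) = m%:R * a - j.+1%:R * pi.
      by rewrite -mt; ring.
    rewrite sinB_natpi -(opprB a) sinN exprS => h.
    by rewrite mulNr h; ring.
  move=> h; rewrite /riesz_weight -/m.
  have -> : (-1) ^+ j * (sin a * sin (m%:R * a) /
    (sin (j.+1%:R * t) * sin (j.+1%:R * t - a))) = 
    ((-1) ^+ j * sin (m%:R * a)) * sin a / (sin (j.+1%:R * t) * sin (j.+1%:R * t - a)).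
    by ring.
  by rewrite -h; field; rewrite st sta.
by ring.
Qed.

(** Since [a] lies before the first node, all four sines have arguments between 0 and [pi]. *)
Lemma riesz_weight_ge0 l a j : (j < 2 * l)%N -> 0 < a < pi / (2 * l).+1%:R ->
  0 <= riesz_weight l a (j.+1%:R * (pi / (2 * l).+1%:R)).
Proof.
move=> jl /andP[a0 am]; set m := (2 * l).+1; set t := pi / m%:R.
rewrite -/m -/t in am; have m0 : (0 : R) < m%:R by rewrite ltr0n.
have m1 : (1 : R) <= m%:R by rewrite ler1n.
have t0 : 0 < t by rewrite divr_gt0 ?pi_gt0.
have mt : m%:R * t = pi by rewrite mulrC divfK ?gt_eqF.
have tpi : t <= pi by rewrite -mt ler_peMl ?(ltW t0).
have tj : j.+1%:R * t < pi by rewrite -mt ltr_pM2r // ltr_nat.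
have ta : t <= j.+1%:R * t by rewrite ler_peMl ?(ltW t0) ?ler1n.
have mapi : m%:R * a < pi by rewrite -mt ltr_pM2l.
have ma0 : 0 < m%:R * a by rewrite mulr_gt0.
rewrite /riesz_weight -/m; apply: divr_ge0; apply: mulr_ge0; apply: sin_ge0_pi;
  apply/andP; split; lra.
Qed.

(* In the interpolation formula the node [j pi / m] has a weight of sign [(-1)^j]
   and the cosine of frequency [m] takes the extreme value [(-1)^j] there. *)
Lemma riesz l n (k : 'I_n -> nat) (f c : 'I_n -> R) a :
  let m := (2 * l).+1 in
  let p x := \sum_i f i * cos ((2 * k i).+1%:R * x + c i) in
  (forall i, (k i <= l)%N) ->
  \sum_i f i * (2 * k i).+1%:R * sin (c i) = 0 ->
  (forall x, p x <= p 0) -> 0 <= a < pi / m%:R ->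
  p 0 * cos (m%:R * a) <= p a.
Proof.
move=> m p kl dp pmax /andP[]; rewrite le_eqVlt => /predU1P[<-|a0] am.
  by rewrite mulr0 cos0 mulr1.
have p0 : p 0 = \sum_i f i * cos (c i).
  by apply: eq_bigr => i _; rewrite mulr0 add0r.
(* Odd frequencies make [p] change sign under a shift by [pi], so its maximum also bounds [- p]. *)
have pN x : - p x <= p 0.
  apply: le_trans (pmax (x + pi)); rewrite -sumrN ler_sum // => i _.
  rewrite -mulrN le_eqVlt; apply/orP; left; apply/eqP; congr (_ * _).
  have -> : (2 * k i).+1%:R * (x + pi) + c i =
    (2 * k i).+1%:R * x + c i + (2 * k i).+1%:R * pi by ring.
  by rewrite cosD_natpi exprS exprM sqrrN !expr1n mulr1 mulN1r.
have m0 : (0 : R) < m%:R by rewrite ltr0n.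
rewrite -(ler_pM2l m0) -subr_ge0.
have a0m : 0 < a < pi / m%:R by rewrite a0.
rewrite [leRHS](_ : _ = \sum_(j < 2 * l) (-1) ^+ j *
    riesz_weight l a (j.+1%:R * (pi / m%:R)) *
    (p (j.+1%:R * (pi / m%:R)) + (-1) ^+ j * p 0)).
  apply: sumr_ge0 => j _; rewrite mulrAC mulr_ge0 //; last first.
    by rewrite riesz_weight_ge0.
  rewrite mulrDr [X in _ + X]mulrA -expr2 sqrr_sign mul1r.
  have := pN (j.+1%:R * (pi / m%:R)); have := pmax (j.+1%:R * (pi / m%:R)).
  by rewrite -signr_odd; case: (odd j); rewrite ?expr0 ?expr1; lra.
transitivity (\sum_i f i * (m%:R *
    (cos ((2 * k i).+1%:R * a + c i) - cos (c i) * cos (m%:R * a)) +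
    (2 * k i).+1%:R * sin (c i) * sin (m%:R * a))).
  (* The added term vanishes by [dp], which says that the derivative of [p] at 0 is zero. *)
  rewrite [LHS](_ : _ = m%:R * p a - m%:R * (p 0 * cos (m%:R * a)) +
    (\sum_i f i * (2 * k i).+1%:R * sin (c i)) * sin (m%:R * a)); last first.
    by rewrite dp mul0r addr0.
  rewrite p0 /p !big_distrl /= !big_distrr /= -sumrB -big_split /=.
  by apply: eq_bigr => i _; ring.
under eq_bigr => i _ do rewrite riesz_interpolation // big_distrr /=.
rewrite exchange_big /=; apply: eq_bigr => j _.
rewrite p0 /p big_distrr -big_split big_distrr /=; apply: eq_bigr => i _.
by rewrite -/m; ring.
Qed.

End Trigonometry.

(** * Inequalities for the sine, and angles on the unit circle *)

Section SineInequalities.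
Context {R : realType}.
Implicit Types a b c x y : R.

Lemma sin_sqrB x y : sin x ^+ 2 - sin y ^+ 2 = sin (x + y) * sin (x - y).
Proof.
rewrite sinD sinB.
transitivity (sin x ^+ 2 * cos y ^+ 2 - cos x ^+ 2 * sin y ^+ 2); last by ring.
by rewrite !cos2sin2; ring.
Qed.

Lemma sin_le_sin_pi_sub a b : 0 <= a -> a <= b -> b <= pi - a -> sin a <= sin b.
Proof.
move=> a0 ab bpi; rewrite -subr_ge0.
have -> : sin b - sin a = 2 * cos ((b + a) / 2) * sin ((b - a) / 2).
  have {1}-> : b = (b + a) / 2 + (b - a) / 2 by field.
  have {3}-> : a = (b + a) / 2 - (b - a) / 2 by field.
  by set u := (b + a) / 2; set v := (b - a) / 2; rewrite (sinD u v) (sinB u v); ring.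
rewrite mulr_ge0 ?mulr_ge0 //; last by apply: sin_ge0_pi; lra.
by apply: cos_ge0_pihalf; lra.
Qed.

(** Induction on [l]. With [c] the old multiple of [b], the right side grows by
    [sin (2 c + 2 b) * sin (2 b)], which is at least [sin (2 b) ^+ 2] and hence at least
    [2 * sin b ^+ 2]. The base case [l = 1] is the triple angle formula; for [l = 0] the inequality
    is false. *)
Lemma sin_sqr_le_sin_mul_sqr l b : (1 <= l)%N ->
  0 <= b -> (2 * l).+1%:R * b <= pi / 2 ->
  (2 * l).+2%:R * sin b ^+ 2 <= sin ((2 * l).+1%:R * b) ^+ 2.
Proof.
elim: l => // -[_ _|l IHl _] b0 mb.
  have -> : (2 * 1).+2%:R = 4 :> R by [].
  rewrite [_ * b](_ : _ = b *+ 2 + b) in mb *; last by rewrite mulr2n; ring.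
  rewrite sinD sin_mulr2n cos_mulr2n.
  have c3 : 0 <= cos (b *+ 2 + b) by apply: cos_ge0_pihalf; lra.
  have c1 : 0 < cos b by apply: cos_gt0_pihalf; have := @pi_gt0 R; lra.
  rewrite cosD cos_mulr2n sin_mulr2n in c3.
  have {}c3 : 0 <= cos b * (4 * cos b ^+ 2 - 3).
    rewrite [leRHS](_ : _ = (cos b ^+ 2 *+ 2 - 1) * cos b -
      (cos b * sin b) *+ 2 * sin b) //.
    transitivity ((cos b ^+ 2 *+ 2 - 1) * cos b - 2 * cos b * sin b ^+ 2); last by ring.
    by rewrite sin2cos2; ring.
  rewrite pmulr_rge0 // in c3.
  rewrite [X in _ <= X ^+ 2](_ : _ = sin b * (4 * cos b ^+ 2 - 1)); last first.
    by rewrite !mulr2n; ring.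
  rewrite exprMn mulrC ler_wpM2l ?sqr_ge0 //.
  by rewrite [leLHS](_ : 4 = 2 ^+ 2) ?ler_sqr ?nnegrE; [lra|lra|lra|ring].
have mE : (2 * l.+2).+1%:R * b = (2 * l.+1).+1%:R * b + 2 * b by ring.
rewrite mE in mb *; set c := (2 * l.+1).+1%:R * b in mb *.
have bc : 3 * b <= c by rewrite ler_wpM2r // ler_nat; lia.
have /(IHl isT b0) IH : c <= pi / 2 by lra.
have := sin_sqrB (c + 2 * b) c.
have -> : c + 2 * b - c = 2 * b by ring.
move=> hs.
have h1 : sin (2 * b) <= sin (c + 2 * b + c) by apply: sin_le_sin_pi_sub; lra.
have h2 : 0 <= sin (2 * b) by apply: sin_ge0_pi; lra.
have h3 : sin (2 * b) ^+ 2 <= sin (c + 2 * b) ^+ 2 - sin c ^+ 2.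
  by rewrite hs expr2 ler_wpM2r.
have h4 : 2 * sin b ^+ 2 <= sin (2 * b) ^+ 2.
  have -> : sin (2 * b) = 2 * (cos b * sin b).
    by rewrite [2 * b]mulr_natl sin_mulr2n mulr_natl.
  rewrite !exprMn.
  have hc : 1 / 2 <= cos b ^+ 2.
    have : 0 <= cos (b *+ 2) by apply: cos_ge0_pihalf; rewrite -mulr_natl; lra.
    by rewrite cos_mulr2n; lra.
  have := sqr_ge0 (sin b); nra.
have -> : (2 * l.+2).+2%:R = (2 * l.+1).+2%:R + 2 :> R by ring.
by rewrite mulrDl; lra.
Qed.

Lemma unit_circle_angle x y : x ^+ 2 + y ^+ 2 = 1 ->
  exists2 t, - pi <= t <= pi & cos t = x /\ sin t = y.
Proof.
move=> xy.
have x1 : -1 <= x <= 1.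
  by rewrite -ler_norml -(@expr_le1 _ 2) // real_normK ?num_real //; have := sqr_ge0 y; lra.
have cx := acosK x1.
have := acos_ge0 x1; have := acos_lepi x1 => tpi t0.
have : sin (acos x) ^+ 2 = y ^+ 2 by rewrite sin2cos2 cx; lra.
move=> /eqP; rewrite eqf_sqr => /orP[]/eqP sy.
  by exists (acos x) => //; lra.
by exists (- acos x); rewrite ?cosN ?sinN ?sy ?opprK //; lra.
Qed.

(** Equal cosines and sines stand for congruence modulo [2 pi], so that no multiple of [2 pi] has to
    be exhibited. *)
Lemma cos_natmul_congr n x y c : cos x = cos y -> sin x = sin y ->
  cos (n%:R * x + c) = cos (n%:R * y + c).
Proof.
move=> cxy sxy.
suff [] : cos (n%:R * x + c) = cos (n%:R * y + c) /\
  sin (n%:R * x + c) = sin (n%:R * y + c) by [].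
elim: n => [|n [cE sE]]; first by rewrite !mul0r.
have E z : n.+1%:R * z + c = n%:R * z + c + z by ring.
by rewrite !E !(cosD _ x, cosD _ y, sinD _ x, sinD _ y) cE sE cxy sxy.
Qed.

End SineInequalities.

(** * Trigonometric polynomials with odd frequencies *)

Section OddTrigonometricPolynomials.
Context {R : realType}.

Definition odd_freq (i : nat) : nat := (2 * i./2).+1.

(** The phase [pi / 2] turns the cosine into a sine at odd indices, so that one formula covers
    both. *)
Definition odd_phase (i : nat) : R := (odd i)%:R * (pi / 2).

(* The trigonometric moment curve: (cos t, sin t, cos 3t, sin 3t, ..). *)
Definition moment_curve n (t : R) : 'rV[R]_n :=
  \row_i cos ((odd_freq i)%:R * t - odd_phase i).

Lemma dot_moment_curve n (x : 'rV[R]_n) t : dot x (moment_curve n t) =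
  \sum_i x 0 i * cos ((odd_freq i)%:R * t - odd_phase i).
Proof. by apply: eq_bigr => i _; rewrite mxE. Qed.

Lemma moment_curve_congr n x y : cos x = cos y -> sin x = sin y ->
  moment_curve n x = moment_curve n y.
Proof.
move=> cxy sxy; apply/rowP => i; rewrite !mxE.
exact: cos_natmul_congr.
Qed.

Lemma moment_curveDpi n t : moment_curve n (t + pi) = - moment_curve n t.
Proof.
apply/rowP => i; rewrite !mxE.
have -> : (odd_freq i)%:R * (t + pi) - odd_phase i =
  (odd_freq i)%:R * t - odd_phase i + (odd_freq i)%:R * pi by ring.
by rewrite cosD_natpi exprS exprM sqrrN !expr1n mulr1 mulN1r.
Qed.

Lemma moment_curve_sqr_norm l n t : (n <= (2 * l).+2)%N ->
  dot (moment_curve n t) (moment_curve n t) <= l.+1%:R.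
Proof.
move=> nl; rewrite /dot; under eq_bigr do rewrite mxE -expr2.
pose F i := cos ((odd_freq i)%:R * t - odd_phase i) ^+ 2.
rewrite (eq_bigr (fun i : 'I_n => F i)) // -(big_mkord xpredT F).
have -> : l.+1%:R = \sum_(0 <= i < (2 * l).+2) F i.
  rewrite mul2n -doubleS; elim: (l.+1) => [|k IHk]; first by rewrite big_geq.
  rewrite doubleS !big_nat_recr //= -IHk -addrA -natr1; congr (_ + _).
  rewrite /F /odd_freq /odd_phase /= odd_double /= uphalf_double doubleK.
  by rewrite mul0r subr0 mul1r cosBpihalf cos2Dsin2.
rewrite [leRHS](big_cat_nat (n := n)) //= lerDl; apply: sumr_ge0 => i _; exact: sqr_ge0.
Qed.

(** Discrete orthogonality: a product of two coordinates splits into cosines of the sum and of the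
    difference of their frequencies. Both sum to 0 by [sum_cos_roots], unless the frequencies agree;
    then the phases separate cosine from sine. *)
Lemma sum_moment_curve_mul l (i j : nat) :
  (i < (2 * l).+2)%N -> (j < (2 * l).+2)%N ->
  \sum_(k < (2 * l).+2)
    cos ((odd_freq i)%:R * (k%:R * (pi / (2 * l).+2%:R)) - odd_phase i) *
    cos ((odd_freq j)%:R * (k%:R * (pi / (2 * l).+2%:R)) - odd_phase j) =
  l.+1%:R * (i == j)%:R.
Proof.
wlog ij : i j / (j./2 <= i./2)%N => [hw|il jl].
  have [|/ltnW ji] := leqP j./2 i./2; first exact: hw.
  move=> il jl; rewrite eq_sym -hw //; apply: eq_bigr => k _; exact: mulrC.
set N := (2 * l).+2; set t := pi / N%:R.
apply: (mulfI (_ : 2 != 0 :> R)) => //.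
transitivity (
  \sum_(k < N) cos (- (odd_phase i + odd_phase j) +
    2 * k%:R * ((i./2 + j./2).+1%:R * pi / N%:R)) +
  \sum_(k < N) cos (odd_phase j - odd_phase i +
    2 * k%:R * ((i./2 - j./2)%:R * pi / N%:R))).
  rewrite -big_split big_distrr; apply: eq_bigr => k _ /=.
  set a := _ * _ - odd_phase i; set b := _ * _ - odd_phase j.
  have -> : - (odd_phase i + odd_phase j) +
    2 * k%:R * ((i./2 + j./2).+1%:R * pi / N%:R) = a + b.
    by rewrite -(mulrA _ pi) -/t /a /b /odd_freq -/t; ring.
  have -> : odd_phase j - odd_phase i +
    2 * k%:R * ((i./2 - j./2)%:R * pi / N%:R) = a - b.
    by rewrite -(mulrA _ pi) -/t /a /b /odd_freq -/t natrB //; ring.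
  by rewrite (cosD a b) (cosB a b); ring.
have hi : (i./2 <= l)%N by rewrite -ltnS ltn_half_double doubleS -mul2n.
have hj : (j./2 <= l)%N by rewrite -ltnS ltn_half_double doubleS -mul2n.
rewrite (@sum_cos_roots _ _ (i./2 + j./2).+1) ?add0r; last by rewrite /N; lia.
have [ij0|ij0] := posnP (i./2 - j./2); last first.
  rewrite sum_cos_roots; last by rewrite /N; lia.
  by case: eqVneq ij0 => [->|]; rewrite ?mulr0 ?subnn.
under eq_bigr do rewrite ij0 !mul0r mulr0 addr0.
rewrite sumr_const card_ord /odd_phase /N.
have E : (i == j) = (odd i == odd j).
  have hij : i./2 = j./2 by apply/eqP; rewrite eqn_leq ij andbT -subn_eq0 ij0.
  apply/eqP/eqP => [->//|oij].
  by rewrite -(odd_double_half i) -(odd_double_half j) oij hij.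
rewrite E; case: (odd i) (odd j) => -[];
  rewrite ?mul0r ?mul1r ?subr0 ?subrr ?sub0r ?cosN ?cos0 ?cos_pihalf /=
    ?mul0rn ?mulr0 //.
- by rewrite mulr1 -natrM; congr (_%:R); lia.
- by rewrite mulr1 -natrM; congr (_%:R); lia.
Qed.

(** Parseval's identity, with an average over [2 l + 2] equidistant samples of a half period in
    place of an integral. *)
Lemma moment_curve_parseval l n (x : 'rV[R]_n) : (n <= (2 * l).+2)%N ->
  \sum_(k < (2 * l).+2)
    dot x (moment_curve n (k%:R * (pi / (2 * l).+2%:R))) ^+ 2 =
  l.+1%:R * dot x x.
Proof.
move=> nl; set t := pi / _.
transitivity (\sum_(i < n) \sum_(j < n) x 0 i * x 0 j *
  \sum_(k < (2 * l).+2) cos ((odd_freq i)%:R * (k%:R * t) - odd_phase i) *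
   cos ((odd_freq j)%:R * (k%:R * t) - odd_phase j)).
  under [RHS]eq_bigr => i _ do (under eq_bigr => j _ do rewrite big_distrr /=).
  under [RHS]eq_bigr do rewrite exchange_big /=.
  rewrite [RHS]exchange_big /=; apply: eq_bigr => k _.
  rewrite dot_moment_curve expr2 big_distrlr /=.
  by apply: eq_bigr => i _; apply: eq_bigr => j _; ring.
rewrite /dot [RHS]big_distrr; apply: eq_bigr => i _ /=.
rewrite (bigD1 i) //= [X in _ + X]big1 ?addr0 => [|j ji].
  by rewrite sum_moment_curve_mul ?eqxx ?(leq_trans (ltn_ord _) nl) // mulr1 mulrC.
rewrite sum_moment_curve_mul ?(leq_trans (ltn_ord _) nl) //.
by rewrite (_ : (i == j :> nat) = false) ?mulr0 //; apply/negbTE; rewrite eq_sym.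
Qed.

Definition attains_max n (x : 'rV[R]_n) t :=
  forall s, dot x (moment_curve n s) <= dot x (moment_curve n t).

(** By antipodal symmetry the maximum bounds the absolute value, so its square is at least the
    average of the sampled squares, which is 1/2. *)
Lemma attains_max_sqr_ge l n (x : 'rV[R]_n) t : (n <= (2 * l).+2)%N ->
  dot x x = 1 -> attains_max x t ->
  0 <= dot x (moment_curve n t) /\ 1 / 2 <= dot x (moment_curve n t) ^+ 2.
Proof.
move=> nl x1 xt.
have xN s : - dot x (moment_curve n s) <= dot x (moment_curve n t).
  have := xt (s + pi); rewrite moment_curveDpi.
  by rewrite -scaleN1r dotZr mulN1r.
have x0 : 0 <= dot x (moment_curve n t).
  by have := xt t; have := xN t; lra.
split=> //; have := moment_curve_parseval x nl; rewrite x1 mulr1 => h.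
have : l.+1%:R <= \sum_(k < (2 * l).+2) dot x (moment_curve n t) ^+ 2.
  rewrite -h; apply: ler_sum => k _.
  rewrite -[leLHS]real_normK ?num_real // ler_sqr ?nnegrE //.
  by rewrite ler_norml xt andbT lerNl.
rewrite sumr_const card_ord -[_ ^+ 2 *+ _]mulr_natl.
have -> : (2 * l).+2%:R = l.+1%:R * 2 :> R by ring.
by rewrite -mulrA -{1}[l.+1%:R]mulr1 ler_pM2l ?ltr0n //; lra.
Qed.

Lemma is_derive_dot_moment_curve n (x : 'rV[R]_n) (t : R) :
  is_derive t 1 (fun s => dot x (moment_curve n s))
    (- \sum_i x 0 i * (odd_freq i)%:R * sin ((odd_freq i)%:R * t - odd_phase i)).
Proof.
have -> : (fun s => dot x (moment_curve n s)) =
    \sum_(i < n) (fun s => x 0 i * cos ((odd_freq i)%:R * s - odd_phase i)).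
  by apply/funext => s; rewrite dot_moment_curve fct_sumE.
rewrite -sumrN; apply: is_derive_sum => i.
pose f : R -> R := fun s => (odd_freq i)%:R * s - odd_phase i.
have df : is_derive t 1 f (odd_freq i)%:R.
  apply: (@is_derive_eq _ _ _ ((odd_freq i)%:R \*: id - cst (odd_phase i))).
  by rewrite subr0 /GRing.scale /= mulr1.
have -> : (fun s => x 0 i * cos ((odd_freq i)%:R * s - odd_phase i)) =
  x 0 i \*: (cos \o f) by [].
apply: is_derive_eq.
by rewrite /GRing.scale /=; ring.
Qed.

Lemma attains_max_exists n (x : 'rV[R]_n) : exists t, attains_max x t.
Proof.
have pi0 := @pi_ge0 R.
have [||c cpi cmax] := @EVT_max R (fun s => dot x (moment_curve n s)) (- pi) pi.
- lra.
- apply: derivable_within_continuous => s _.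
  by have [] := is_derive_dot_moment_curve x s.
exists c => s.
have [t tpi [ct st]] := unit_circle_angle (cos2Dsin2 s).
rewrite -(moment_curve_congr n ct st); apply: cmax.
by rewrite in_itv.
Qed.

Lemma attains_max_derive n (x : 'rV[R]_n) t : attains_max x t ->
  \sum_i x 0 i * (odd_freq i)%:R * sin ((odd_freq i)%:R * t - odd_phase i) = 0.
Proof.
move=> xt.
have [] := @derive1_at_max R (fun s => dot x (moment_curve n s)) (t - 1) (t + 1) t.
- lra.
- by move=> s _; have [] := is_derive_dot_moment_curve x s.
- by rewrite in_itv /=; lra.
- by move=> s _; exact: xt.
move=> _; have [_ ->] := is_derive_dot_moment_curve x t.
by move/eqP; rewrite oppr_eq0 => /eqP.
Qed.

Lemma attains_max_riesz l n (x : 'rV[R]_n) t a (e : bool) : (n <= (2 * l).+2)%N ->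
  attains_max x t -> 0 <= a < pi / (2 * l).+1%:R ->
  dot x (moment_curve n t) * cos ((2 * l).+1%:R * a) <=
  dot x (moment_curve n (t + (-1) ^+ e * a)).
Proof.
move=> nl xt al.
(* These phases absorb both the translation by [t] and the reflection chosen by [e], so that [riesz]
   applies at 0 and to the right of it. *)
pose c (i : 'I_n) := (-1) ^+ e * ((odd_freq i)%:R * t - odd_phase i) : R.
have E b : \sum_i x 0 i * cos ((2 * i./2).+1%:R * b + c i) =
    dot x (moment_curve n (t + (-1) ^+ e * b)).
  rewrite dot_moment_curve; apply: eq_bigr => i _; congr (_ * _); rewrite /c /odd_freq.
  by case: e {c}; rewrite ?expr1 ?expr0; [rewrite -cosN|]; congr cos; ring.
have /= := @riesz R l n (fun i => i./2) (fun i => x 0 i) c a.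
rewrite !E mulr0 addr0; apply => //.
- by move=> i; have := ltn_ord i; lia.
- transitivity ((-1) ^+ e * \sum_(i < n) x 0 i * (odd_freq i)%:R *
    sin ((odd_freq i)%:R * t - odd_phase i)); last by rewrite attains_max_derive ?mulr0.
  rewrite big_distrr.
  apply: eq_bigr => i _ /=; rewrite /c /odd_freq.
  by case: e {c E}; rewrite ?expr1 ?expr0 ?mulN1r ?sinN ?mul1r //; ring.
- by move=> b; rewrite E; exact: xt.
Qed.

Lemma dist_ge_of_max l n (x y : sphere R n) t a (e : bool) : (1 <= l)%N ->
  (n <= (2 * l).+1)%N ->
  attains_max (val x) t -> attains_max (- val y) (t + (-1) ^+ e * (2 * a)) ->
  0 <= a <= pi / (2 * l).+1%:R / 2 ->
  pi / (2 * l).+1%:R - 2 * a <= acos (dot x y).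
Proof.
move=> l1 nl xt yt /andP[a0 am]; set m := (2 * l).+1.
have nl1 : (n.+1 <= (2 * l).+2)%N by [].
have m0 : (0 : R) < m%:R by rewrite ltr0n.
have pi0 := @pi_gt0 R.
set s := pi / m%:R in am *.
have s0 : 0 < s by rewrite divr_gt0.
have ms : m%:R * s = pi by rewrite mulrC divfK ?gt_eqF.
have aI : 0 <= a < pi / (2 * l).+1%:R by rewrite a0 -/m -/s; lra.
set u := t + (-1) ^+ e * a.
have := attains_max_riesz e nl1 xt aI; rewrite -/m -/u.
have := attains_max_riesz (~~ e) nl1 yt aI; rewrite -/m.
have -> : t + (-1) ^+ e * (2 * a) + (-1) ^+ (~~ e) * a = u.
  by rewrite /u signrN; ring.
have y1 : dot (- val y) (- val y) = 1.
  by rewrite -scaleN1r dotZl dotZr sphere_dot; ring.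
have [] := attains_max_sqr_ge nl1 (sphere_dot x) xt.
have [] := attains_max_sqr_ge nl1 y1 yt.
set A := dot _ (moment_curve _ t); set B := dot _ (moment_curve _ (t + _)).
move=> B0 B2 A0 A2; set C := cos _ => hB hA.
(* The angle [b = s / 2 - a] is half the distance to be reached, and it turns the Riesz factor
   [C = cos (m a)] into [sin (m b)]. *)
have ma : m%:R * (s / 2 - a) = pi / 2 - m%:R * a by rewrite mulrBr mulrA ms.
set b := s / 2 - a in ma.
have b0 : 0 <= b by rewrite /b; lra.
have mb0 : 0 <= m%:R * b by rewrite mulr_ge0 // ltW.
have ma0 : 0 <= m%:R * a by rewrite mulr_ge0 // ltW.
have CE : C = sin (m%:R * b) by rewrite ma -cosBpihalf -cosN; congr cos; ring.
have C0 : 0 <= C by apply: cos_ge0_pihalf; lra.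
have := @sin_sqr_le_sin_mul_sqr R l b l1 b0; rewrite -/m -CE => /(_ _)bC.
have {}bC : (2 * l).+2%:R * sin b ^+ 2 <= C ^+ 2 by apply: bC; lra.
have := dot_CauchySchwarz (val x - val y) (moment_curve n.+1 u).
have uE : dot (val x - val y) (moment_curve n.+1 u) =
    dot x (moment_curve n.+1 u) + dot (- val y) (moment_curve n.+1 u).
  by rewrite dotBl -[in RHS]scaleN1r dotZl mulN1r.
have xyE : dot (val x - val y) (val x - val y) = 2 - 2 * dot x y.
  by rewrite !(dotBl, dotBr) !sphere_dot (dotC (val y)); ring.
rewrite uE xyE.
have := @moment_curve_sqr_norm l n.+1 u nl1.
set D := dot (moment_curve _ u) _ => hD CS.
set d := dot x y in CS *.
have d1 : -1 <= d <= 1 := sphere_dot_itv x y.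
(* Cauchy-Schwarz at the midpoint [u]: the left side comes from [(A + B) ^+ 2 >= 2], the factor
   [l + 1] from the norm of the moment curve. *)
have {}CS : 2 * C ^+ 2 <= (2 - 2 * d) * l.+1%:R.
  apply: (@le_trans _ _ ((2 - 2 * d) * D)); last by rewrite ler_wpM2l //; lra.
  apply: le_trans CS.
  have h : (A + B) * C <= dot x (moment_curve n.+1 u) + dot (- val y) (moment_curve n.+1 u).
    by rewrite mulrDl; lra.
  have AB : 2 <= (A + B) ^+ 2.
    have AB1 : 1 / 2 <= A * B.
      have h2 : 0 <= 1 / 2 :> R by lra.
      rewrite -ler_sqr ?nnegrE ?(mulr_ge0 A0 B0) // [leRHS]exprMn [leLHS]expr2.
      exact: (ler_pM h2 h2 A2 B2).
    by rewrite [leRHS](_ : _ = A ^+ 2 + B ^+ 2 + 2 * (A * B)); [lra|ring].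
  apply: (@le_trans _ _ (((A + B) * C) ^+ 2)).
    by rewrite exprMn ler_wpM2r ?sqr_ge0.
  have ABC0 : 0 <= (A + B) * C by rewrite mulr_ge0 ?addr_ge0.
  by rewrite ler_sqr ?nnegrE // (le_trans ABC0 h).
rewrite leNgt; apply/negP => lt.
have : cos (s - 2 * a) < cos (acos d).
  have spi : s <= pi by rewrite -ms ler_peMl ?(ltW s0) ?ler1n.
  by rewrite ltr_cos // in_itv /= ?acos_ge0 ?acos_lepi //; lra.
rewrite acosK //.
have -> : s - 2 * a = b *+ 2 by rewrite /b mulr2n; field.
rewrite cos_mulr2n cos2sin2 mulr2n => lt2.
have : 2 * ((2 * l).+2%:R * sin b ^+ 2) <= (2 - 2 * d) * l.+1%:R.
  by apply: le_trans CS; rewrite ler_pM2l.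
have -> : 2 * ((2 * l).+2%:R * sin b ^+ 2) = 4 * sin b ^+ 2 * l.+1%:R by ring.
by rewrite ler_pM2r ?ltr0n //; lra.
Qed.

End OddTrigonometricPolynomials.

(** * The upper bound *)

Section UpperBound.
Local Open Scope classical_set_scope.
Context {R : realType}.

Lemma dot_moment_curve2 (s t : R) :
  dot (moment_curve 2 s) (moment_curve 2 t) = cos (s - t).
Proof.
rewrite /dot !big_ord_recl big_ord0 !mxE /odd_freq /odd_phase /=.
by rewrite /bump /= !mul1r !mul0r !subr0 !cosBpihalf addr0 cosB.
Qed.

Lemma circle_subproof (t : R) : dot (moment_curve 2 t) (moment_curve 2 t) == 1.
Proof. by rewrite dot_moment_curve2 subrr cos0. Qed.

Definition circle (t : R) : sphere R 1 := Sphere (circle_subproof t).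

Lemma circle_onto (z : sphere R 1) : exists t, z = circle t.
Proof.
have := sphere_dot z; rewrite /dot !big_ord_recl big_ord0 addr0 -!expr2.
move=> /unit_circle_angle[t _ [ct st]]; exists t; apply/val_inj/rowP => i.
rewrite mxE; case: i => -[|[|//]] i2; rewrite /odd_freq /odd_phase /= !mul1r.
  by rewrite mul0r subr0 ct; congr (sphere_val z _ _); apply: val_inj.
by rewrite cosBpihalf st; congr (sphere_val z _ _); apply: val_inj.
Qed.

Lemma sphere_opp_subproof n (x : sphere R n) : dot (- val x) (- val x) == 1.
Proof. by rewrite -scaleN1r dotZl dotZr sphere_dot; apply/eqP; ring. Qed.

Definition sphere_opp n (x : sphere R n) : sphere R n :=
  Sphere (sphere_opp_subproof x).

Lemma dot_sphere_oppr n (x y : sphere R n) : dot x (sphere_opp y) = - dot x y.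
Proof. by rewrite -[val (sphere_opp y)]scaleN1r dotZr mulN1r. Qed.

Lemma acos_dot_opp n (x y : sphere R n) :
  acos (dot x (sphere_opp y)) = pi - acos (dot x y).
Proof. by rewrite dot_sphere_oppr acosN ?sphere_dot_itv. Qed.

Lemma attains_max_opp n (x : 'rV[R]_n) t s : attains_max x t ->
  moment_curve n s = - moment_curve n t -> attains_max (- x) s.
Proof.
move=> xt st u; have := xt (u + pi).
by rewrite st moment_curveDpi -scaleN1r -(scaleN1r x) -(scaleN1r (moment_curve n t))
  !dotZl !dotZr !mulN1r opprK.
Qed.

Lemma dist_circle_le l n (x y : sphere R n) (s t : R) : (1 <= l)%N ->
  (n <= (2 * l).+1)%N -> attains_max (val x) t -> attains_max (val y) s ->
  acos (cos (t - s)) <= acos (dot x y) + (pi - pi / (2 * l).+1%:R).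
Proof.
move=> l1 nl xt ys.
set r := pi / (2 * l).+1%:R.
have cI : -1 <= cos (t - s) <= 1 by rewrite cos_geN1 cos_le1.
set d := acos (cos _).
have d0 : 0 <= d := acos_ge0 cI.
have dpi : d <= pi := acos_lepi cI.
have a0 := acos_ge0 (sphere_dot_itv x y).
have [dl|dm] := leP d (pi - r); first by lra.
have [e [ce se]] : exists e : bool,
    cos (t + (-1) ^+ e * d) = cos s /\ sin (t + (-1) ^+ e * d) = sin s.
  have cd : cos d = cos (s - t) by rewrite acosK // -cosN opprB.
  have : sin d ^+ 2 = sin (s - t) ^+ 2 by rewrite !sin2cos2 cd.
  have {2 3}-> : s = t + (s - t) by ring.
  move=> /eqP; rewrite eqf_sqr => /orP[]/eqP sd.
    by exists false; rewrite expr0 mul1r (cosD t d) (cosD t (s - t)) (sinD t d)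
      (sinD t (s - t)) cd sd.
  exists true; rewrite expr1 mulN1r (cosD t (- d)) (cosD t (s - t)).
  by rewrite (sinD t (- d)) (sinD t (s - t)) cosN sinN cd sd opprK.
(* The antipode of [s] is reached from [t] by turning [pi - d] in the opposite direction, hence
   [~~ e]; there [- y] is maximal. *)
have h : attains_max (- val y) (t + (-1) ^+ (~~ e) * (2 * ((pi - d) / 2))).
  apply: attains_max_opp ys _.
  rewrite -(moment_curve_congr _ ce se) -[LHS]opprK.
  rewrite -[X in - X = _]moment_curveDpi; congr (- _).
  apply: moment_curve_congr; case: (e); rewrite ?expr0 ?expr1.
  - have -> : t + 1 * (2 * ((pi - d) / 2)) + pi = t - 1 * d + pi *+ 2.
      by rewrite mulr2n; field.
    by rewrite cosD2pi; congr cos; ring.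
  - by congr cos; field.
  - have -> : t + 1 * (2 * ((pi - d) / 2)) + pi = t - 1 * d + pi *+ 2.
      by rewrite mulr2n; field.
    by rewrite sinD2pi; congr sin; ring.
  - by congr sin; field.
have := @dist_ge_of_max R l n x y t ((pi - d) / 2) (~~ e) l1 nl xt h.
have -> : 2 * ((pi - d) / 2) = pi - d by field.
move=> /(_ _) hh; have {}hh : r - (pi - d) <= acos (dot x y).
  by apply: hh; rewrite -/r; lra.
by lra.
Qed.

Definition max_relation n : set (sphere R 1 * sphere R n) :=
  [set p | exists2 t, p.1 = circle t & attains_max (val p.2) t].

Lemma max_relation_correspondence n : (1 <= n)%N -> correspondence (@max_relation n).
Proof.
case: n => // n _; split; apply/seteqP; split=> // u _ /=.
  have [t ut] := circle_onto u.
  (* The point with first coordinates [cos t], [sin t] has the polynomial [cos (t - s)], which is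
     maximal at [t]. *)
  pose x : 'rV[R]_n.+2 := \row_i (if (i < 2)%N then
    cos ((odd_freq i)%:R * t - odd_phase i) else 0).
  have xE s : dot x (moment_curve n.+2 s) = cos (t - s).
    rewrite -dot_moment_curve2 /dot !big_ord_recl big_ord0 /= !mxE.
    by rewrite [X in _ + (_ + X)]big1 // => i _; rewrite !mxE /= mul0r.
  have x1 : dot x x == 1.
    suff -> : dot x x = dot x (moment_curve n.+2 t) by rewrite xE subrr cos0.
    apply: eq_bigr => i _; rewrite !mxE; case: ifP => _ //; by rewrite !mul0r.
  exists (u, Sphere x1) => //; exists t => // s /=.
  by rewrite !xE subrr cos0 cos_le1.
have [t ut] := attains_max_exists (val u).
by exists (circle t, u) => //; exists t.
Qed.

(** One side of the absolute value is [dist_circle_le] for [x] and [y]. The other is the same bound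
    for [x] and the antipode of [y], which replaces both distances by [pi] minus them. *)
Lemma distortion_max_relation l n : (1 <= l)%N -> (n <= (2 * l).+1)%N ->
  (distortion (@max_relation n) <= (pi - pi / (2 * l).+1%:R)%:E)%E.
Proof.
move=> l1 nl; apply: ge_ereal_sup => _ [[z x] [t /= -> xt]] [[w y] [s /= -> ys]] <-.
rewrite lee_fin !sphere_mdistE dot_moment_curve2 ler_norml.
have h1 := dist_circle_le l1 nl xt ys.
have ys' : attains_max (val (sphere_opp y)) (s + pi).
  by apply: attains_max_opp ys _; rewrite moment_curveDpi.
have := dist_circle_le l1 nl xt ys'.
rewrite acos_dot_opp opprD addrA.
have -> : cos (t - s - pi) = - cos (t - s).
  by rewrite -[RHS]cosDpi; rewrite -(cosD2pi (t - s - pi)); congr cos; rewrite mulr2n; ring.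
rewrite acosN ?cos_geN1 ?cos_le1 //; move: h1; set r := pi / _ => h1 h2.
by lra.
Qed.

End UpperBound.

(** * Ky Fan's lemma *)

Section Coboundary.
Context {T : Type}.
Implicit Types (s : seq T) (phi psi : seq T -> bool).

(** Simplices are vertex lists and [phi] is a mod 2 cochain: its values on the lists with one vertex
    deleted are added. The empty list counts as a face, so the complex is augmented. *)
Fixpoint coboundary phi s : bool :=
  if s is x :: s' then phi s' (+) coboundary (fun t => phi (x :: t)) s' else false.

Lemma eq_coboundary phi psi s : phi =1 psi -> coboundary phi s = coboundary psi s.
Proof.
elim: s phi psi => //= x s IHs phi psi E; rewrite E; congr (_ (+) _).
by apply: IHs => t; rewrite E.
Qed.

Lemma coboundary_add phi psi s :
  coboundary (fun t => phi t (+) psi t) s = coboundary phi s (+) coboundary psi s.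
Proof. by elim: s phi psi => //= x s IHs phi psi; rewrite IHs addbACA. Qed.

(** The usual triangulation of a homotopy from [g] to [h]: each simplex follows [g] up to some
    vertex, which it repeats under [h], and [h] from there on. *)
Fixpoint prism (g h : T -> T) s : seq (seq T) :=
  if s is x :: s' then
    (g x :: map h s) :: [seq g x :: t | t <- prism g h s'] else [::].

(** The chain homotopy formula of the prism operator, evaluated on a cochain; signs disappear mod
    2. *)
Lemma coboundary_prism phi g h s :
  (\big[addb/false]_(t <- prism g h s) coboundary phi t) (+)
    coboundary (fun r => \big[addb/false]_(t <- prism g h r) phi t) s =
  phi (map h s) (+) phi (map g s).
Proof.
elim: s phi => [|x s IHs] phi; first by rewrite /= big_nil !addbb.
have pE psi r : \big[addb/false]_(t <- prism g h (x :: r)) psi t =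
    psi (g x :: map h (x :: r)) (+) \big[addb/false]_(t <- prism g h r) psi (g x :: t).
  by rewrite big_cons big_map.
rewrite pE [X in _ (+) X]/= -/prism (eq_coboundary _ (pE phi)) coboundary_add big_split /=.
have cmap psi : coboundary psi (map h s) = coboundary (fun t => psi (map h t)) s.
  by elim: (s) psi => //= y r IHr psi; rewrite IHr.
rewrite -/(coboundary _ _) cmap.
have := IHs (fun t => phi (g x :: t)).
set c1 := \big[_/_]_(_ <- _) phi _.
set c2 := \big[_/_]_(_ <- _) coboundary _ _.
set c3 := coboundary (fun r => \big[_/_]_(_ <- _) _) s.
set c4 := coboundary _ s.
case: c1 c2 c3 c4 (phi _) (phi _) (phi _) => [] [] [] [] [] [] [] //.
Qed.

End Coboundary.

Lemma coboundary_map (S T : Type) (f : S -> T) phi s :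
  coboundary phi (map f s) = coboundary (fun t => phi (map f t)) s.
Proof. by elim: s phi => //= x s IHs phi; rewrite IHs. Qed.

(** * Antipodal mod 2 chains on spheres and their boundaries *)

Section HemisphereChains.
Context {T : Type} (x0 : T) (op : T -> T) (g : nat -> nat -> T -> T) (N : nat).
Hypothesis opK : involutive op.
Hypothesis g0 : forall k x, g k 0 x = x.
Hypothesis gN : forall k, exists y, forall x, g k N x = y.

Definition chain_sum (phi : seq T -> bool) c := \big[addb/false]_(s <- c) phi s.

Definition with_antipode (c : seq (seq T)) := c ++ map (map op) c.

Lemma chain_sum_with_antipode phi c : chain_sum phi (with_antipode c) =
  chain_sum phi c (+) chain_sum (fun s => phi (map op s)) c.
Proof. by rewrite /chain_sum big_cat big_map. Qed.

(* A mod 2 chain on the [k]-sphere whose boundary is the [(k-1)]-sphere: the trace of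
   the homotopy [g] pushing the [(k-1)]-sphere to the pole. *)
Fixpoint hemisphere k : seq (seq T) :=
  if k is k'.+1 then
    flatten [seq flatten [seq prism (g k' j) (g k' j.+1) s
      | s <- with_antipode (hemisphere k')] | j <- iota 0 N]
  else [:: [:: x0]].

Lemma chain_sum_hemisphere phi k : chain_sum phi (hemisphere k.+1) =
  \big[addb/false]_(j <- iota 0 N)
    chain_sum (fun s => \big[addb/false]_(t <- prism (g k j) (g k j.+1) s) phi t)
      (with_antipode (hemisphere k)).
Proof.
rewrite /chain_sum /= big_flatten big_map; apply: eq_bigr => j _.
by rewrite big_flatten big_map.
Qed.

(** The prism formula, summed over the steps [j], telescopes. The map at step 0 is the identity and
    gives the sphere; the map at step [N] is constant, so a simplex and its antipode have the same
    image and cancel. *)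
Lemma coboundary_hemisphereS phi k :
  (forall psi, chain_sum (coboundary psi) (with_antipode (hemisphere k)) = false) ->
  chain_sum (coboundary phi) (hemisphere k.+1) =
  chain_sum phi (with_antipode (hemisphere k)).
Proof.
move=> Z; rewrite chain_sum_hemisphere.
pose G j s := phi (map (g k j) s).
transitivity (\big[addb/false]_(j <- iota 0 N)
    (chain_sum (G j.+1) (with_antipode (hemisphere k)) (+)
     chain_sum (G j) (with_antipode (hemisphere k)))).
  apply: eq_bigr => j _; rewrite -big_split.
  transitivity (chain_sum (fun s => \big[addb/false]_(t <- prism (g k j) (g k j.+1) s)
      coboundary phi t) (with_antipode (hemisphere k)) (+)
    chain_sum (coboundary (fun r => \big[addb/false]_(t <- prism (g k j) (g k j.+1) r)
      phi t)) (with_antipode (hemisphere k))); first by rewrite Z addbF.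
  rewrite /chain_sum -big_split /=; apply: eq_bigr => s _.
  by rewrite coboundary_prism.
transitivity (chain_sum (G N) (with_antipode (hemisphere k)) (+)
    chain_sum (G 0) (with_antipode (hemisphere k))).
  elim: (N) => [|n IHn]; first by rewrite big_nil addbb.
  rewrite -addn1 iotaD big_cat IHn big_seq1 add0n addn1 /=.
  by rewrite addbC -addbA addbA; do 3![case: (chain_sum _ _)].
have [y gNy] := gN k.
have -> : chain_sum (G N) (with_antipode (hemisphere k)) = false.
  rewrite chain_sum_with_antipode /chain_sum -big_split big1 //= => s _.
  rewrite /G -map_comp; have gE r : map (g k N) r = nseq (size r) y.
    by elim: r => //= z r ->; rewrite gNy.
  by rewrite map_comp !gE size_map addbb.
by rewrite addFb; apply: eq_bigr => s _; rewrite /G (eq_map (g0 k)) map_id.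
Qed.

(** Opposite hemispheres have the same boundary, an antipodally invariant sphere one dimension
    lower, and cancel mod 2. *)
Lemma coboundary_sphere psi k :
  chain_sum (coboundary psi) (with_antipode (hemisphere k)) = false.
Proof.
elim: k psi => [|k IHk] psi.
  (* Each of the two antipodal vertices contributes [psi [::]]. *)
  by rewrite /chain_sum /= !big_cons big_nil /= !addbF addbb.
rewrite chain_sum_with_antipode coboundary_hemisphereS //.
have -> : chain_sum (fun s => coboundary psi (map op s)) (hemisphere k.+1) =
    chain_sum (coboundary (fun s => psi (map op s))) (hemisphere k.+1).
  by apply: eq_bigr => s _; rewrite coboundary_map.
rewrite coboundary_hemisphereS // !chain_sum_with_antipode.
have -> : chain_sum (fun s => psi (map op (map op s))) (hemisphere k) =
    chain_sum psi (hemisphere k).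
  by apply: eq_bigr => s _; rewrite -map_comp (eq_map opK) map_id.
by rewrite [X in _ (+) X]addbC addbb.
Qed.

Lemma coboundary_hemisphere phi k : chain_sum (coboundary phi) (hemisphere k.+1) =
  chain_sum phi (with_antipode (hemisphere k)).
Proof. by apply: coboundary_hemisphereS => psi; exact: coboundary_sphere. Qed.

End HemisphereChains.

(** * Parity of alternating label sequences *)

Section AlternatingSimplices.
Context {disp : Order.disp_t} {K : orderType disp}.
Local Notation label := (K *l bool)%type.
Implicit Types (L M : seq label) (b : bool).

Fixpoint alternates b (s : seq bool) : bool :=
  if s is x :: s' then (x == b) && alternates (~~ b) s' else true.

(** In a nonempty alternating sequence only the deletion of one end gives a face that alternates
    from [b]. In any other sequence such faces come in pairs, from the two members of a repeated
    sign. *)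
Lemma coboundary_alternates b s :
  coboundary (alternates b) s = alternates b s (+) alternates (~~ b) s.
Proof.
elim: s b => [|x s IHs] b //=.
have -> : coboundary (fun t => (x == b) && alternates (~~ b) t) s =
    (x == b) && coboundary (alternates (~~ b)) s.
  by case: (x == b) => //=; elim: (s) => //= y r ->.
by rewrite IHs !negbK; case: x b => -[] /=;
  case: (alternates true s) (alternates false s) => -[].
Qed.

Definition label_alternates b L := alternates b [seq p.2 | p <- sort <=%O L].

Lemma label_alternates_perm b L M :
  perm_eq L M -> label_alternates b L = label_alternates b M.
Proof. by move=> /perm_sort_leP; rewrite /label_alternates => ->. Qed.

(** For a symmetric [phi], deleting a position amounts to deleting a value with [rem], which makes
    the sum independent of the order. *)
Lemma coboundary_perm (phi : seq label -> bool) L M :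
  (forall L M, perm_eq L M -> phi L = phi M) ->
  perm_eq L M -> coboundary phi L = coboundary phi M.
Proof.
move=> phiP LM.
suff E N : coboundary phi N = \big[addb/false]_(p <- N) phi (rem p N).
  rewrite !E (perm_big M) //=; apply: eq_bigr => p _; apply: phiP.
  by apply/permP => a; rewrite !count_rem (permP LM) (perm_mem LM).
suff H pre : coboundary (fun t => phi (pre ++ t)) N =
    \big[addb/false]_(p <- N) phi (rem p (pre ++ N)) by exact: (H [::]).
elim: N pre => [|x s IHs] pre; first by rewrite big_nil.
rewrite big_cons /=; congr (_ (+) _).
  apply: phiP; apply/permP => a.
  by rewrite count_rem mem_cat mem_head orbT !count_cat /=; lia.
by rewrite -cat_rcons -IHs; apply: eq_coboundary => t; rewrite cat_rcons.
Qed.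

(** After sorting, all faces are sublists of a sorted list, so they need no sorting and
    [coboundary_alternates] applies to the signs. *)
Lemma coboundary_label_alternates b L : coboundary (label_alternates b) L =
  label_alternates b L (+) label_alternates (~~ b) L.
Proof.
have LS : perm_eq L (sort <=%O L) by rewrite perm_sym perm_sort.
rewrite (coboundary_perm (@label_alternates_perm b) LS).
rewrite /label_alternates -coboundary_alternates coboundary_map.
have : sorted <=%O (sort <=%O L) by exact: sort_le_sorted.
move: (sort _ L) => S Ss.
suff H (phi psi : seq label -> bool) M : sorted <=%O M ->
   (forall N, subseq N M -> phi N = psi N) -> coboundary phi M = coboundary psi M.
  apply: H => // N NS; rewrite sort_le_id //.
  exact: (subseq_sorted le_trans NS).
elim: M phi psi => //= x s IHs phi psi xs E; congr (_ (+) _).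
  by apply: E; exact: subseq_cons.
apply: IHs => [|N Ns]; first exact: path_sorted xs.
by apply: E; rewrite /= eqxx.
Qed.

Definition flip (p : label) : label := (p.1, ~~ p.2).

Definition consistent L := {in L &, forall p q, p.1 = q.1 -> p.2 = q.2}.

(** Signs only break ties of the lexicographic order; consistency leaves no tie between opposite
    signs, so flipping preserves the order. *)
Lemma label_alternates_flip b L : consistent L ->
  label_alternates b (map flip L) = label_alternates (~~ b) L.
Proof.
move=> cL; rewrite /label_alternates.
have -> : sort <=%O (map flip L) = map flip (sort <=%O L).
  apply: (@le_sorted_eq _ label); first exact: sort_le_sorted.
    apply: (homo_sorted_in (P := mem L) (e := <=%O)) (sort_le_sorted L); last first.
      by apply/allP => p; rewrite mem_sort.
    move=> [p a] [q b'] pL qL; rewrite !leEprodlexi /= => /andP[pq ab].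
    rewrite pq; apply/implyP => qp.
    by have /= -> := cL _ _ pL qL; rewrite ?lexx //; apply: le_anti; rewrite pq.
  by rewrite perm_sort perm_map // perm_sym perm_sort.
rewrite -map_comp; elim: (sort _ L) b => //= p s IHs b; rewrite IHs negbK.
by congr (_ && _); case: p.2 b => -[].
Qed.

End AlternatingSimplices.

(* By [coboundary_label_alternates] and [coboundary_hemisphere], the parity of the number
   of alternating simplices is the same in all the hemispheres. *)
Lemma fan disp (K : orderType disp) (T : eqType) (x0 : T) (op : T -> T)
    (g : nat -> nat -> T -> T) (N : nat) (lab : T -> (K *l bool)%type) (n : nat) :
  involutive op -> (forall k x, g k 0 x = x) ->
  (forall k, exists y, forall x, g k N x = y) ->
  (forall x, lab (op x) = flip (lab x)) ->
  (forall k s, (k <= n)%N -> s \in hemisphere x0 op g N k -> consistent (map lab s)) ->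
  exists2 s, s \in hemisphere x0 op g N n &
    exists b, label_alternates b (map lab s).
Proof.
move=> opK g0 gN labN cons.
pose h := hemisphere x0 op g N.
suff odd_h k : (k <= n)%N -> chain_sum (fun s => label_alternates true (map lab s) (+)
    label_alternates false (map lab s)) (h k) = true.
  have := odd_h n (leqnn n); rewrite /chain_sum => hn.
  have [/hasP[s sh alt_s]|/hasPn no] := boolP (has (fun s =>
     label_alternates true (map lab s) || label_alternates false (map lab s)) (h n)).
    by exists s => //; case/orP: alt_s; [exists true|exists false].
  move: hn; rewrite big_seq big1 // => s /no.
  by case: (label_alternates true _); case: (label_alternates false _).
elim: k => [|k IHk] kn.
  rewrite /chain_sum big_seq1 /label_alternates /= /sort /=.
  by case: (lab x0).2.
rewrite -[RHS](IHk (ltnW kn)).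
transitivity (chain_sum (coboundary (fun s => label_alternates true (map lab s))) (h k.+1)).
  by apply: eq_bigr => s _; rewrite -(coboundary_map lab (label_alternates true))
    coboundary_label_alternates.
(* On the boundary sphere, an antipodal simplex alternating from [true] is the image of one
   alternating from [false], so the count becomes that of hemisphere [k]. *)
rewrite coboundary_hemisphere // chain_sum_with_antipode /chain_sum -big_split.
rewrite [LHS]big_seq [RHS]big_seq; apply: eq_bigr => s sh /=; congr (_ (+) _).
rewrite -map_comp (eq_map (labN : lab \o op =1 flip \o lab)) map_comp.
by rewrite label_alternates_flip //; apply: cons sh; exact: ltnW.
Qed.

(** * Fine chains on spheres *)

Lemma mem_prism (T : eqType) (u v : T -> T) (s t : seq T) y :
  t \in prism u v s -> y \in t -> exists2 x, x \in s & y = u x \/ y = v x.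
Proof.
elim: s t => [|x s IHs] t //=; rewrite inE => /predU1P[->|/mapP[r rp ->]].
  rewrite !inE => /orP[/eqP->|/orP[/eqP->|/mapP[z zs ->]]].
  - by exists x; rewrite ?mem_head //; left.
  - by exists x; rewrite ?mem_head //; right.
  - by exists z; rewrite ?inE ?zs ?orbT //; right.
rewrite inE => /predU1P[->|yr]; first by exists x; rewrite ?mem_head //; left.
by have [z zs yz] := IHs _ rp yr; exists z; rewrite // inE zs orbT.
Qed.

Lemma size_prism (T : eqType) (u v : T -> T) (s t : seq T) :
  t \in prism u v s -> size t = (size s).+1.
Proof.
elim: s t => [|x s IHs] t //=; rewrite inE => /predU1P[->|/mapP[r rp ->]] /=.
  by rewrite size_map.
by rewrite (IHs _ rp).
Qed.

Lemma mem_hemisphereS (T : eqType) (x0 : T) op g N k t :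
  t \in hemisphere x0 op g N k.+1 -> exists j s, [/\ (j < N)%N,
    t \in prism (g k j) (g k j.+1) s &
    exists2 r, r \in hemisphere x0 op g N k & s = r \/ s = map op r].
Proof.
move=> /= /flattenP[c /mapP[j]]; rewrite mem_iota => jN -> /flattenP[d /mapP[s sd ->] td].
exists j, s; split=> //; move: sd; rewrite mem_cat => /orP[sr|/mapP[r rh ->]].
  by exists s => //; left.
by exists r => //; right.
Qed.

Section FineChains.
Context {R : realType} {n : nat}.
Implicit Types (x y : sphere R n).

Lemma pole_subproof k :
  dot (delta_mx 0 (inord k) : 'rV[R]_n.+1) (delta_mx 0 (inord k)) == 1.
Proof.
rewrite /dot (bigD1 (inord k)) //= big1 ?addr0 ?mxE ?eqxx ?mulr1 // => i ik.
by rewrite !mxE (negbTE ik) andbF mulr0.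
Qed.

Definition pole k : sphere R n := Sphere (pole_subproof k).

(* Moves [x] by [j] of the [N] equal steps from the equator orthogonal to [pole k.+1] to
   that pole. On the equator the vector has norm 1, so the default [x] is not used. *)
Definition tilt (N k j : nat) x : sphere R n :=
  insubd x (cos (j%:R / N%:R * (pi / 2)) *: val x +
            sin (j%:R / N%:R * (pi / 2)) *: val (pole k.+1)).

Lemma tilt0 N k x : tilt N k 0 x = x.
Proof.
by apply: val_inj; rewrite val_insubd !mul0r cos0 sin0 scale1r scale0r addr0 if_same.
Qed.

Lemma tilt_end N k x : (0 < N)%N -> tilt N k N x = pole k.+1.
Proof.
move=> N0; apply: val_inj; rewrite val_insubd divff ?pnatr_eq0 -?lt0n // mul1r.
by rewrite cos_pihalf sin_pihalf scale0r scale1r add0r pole_subproof.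
Qed.

Definition in_coordinate_sphere k x := forall i : 'I_n.+1, (k < i)%N -> val x 0 i = 0.

Lemma dot_pole k x : (k < n)%N -> in_coordinate_sphere k x ->
  dot x (pole k.+1) = 0.
Proof.
move=> kn xk; rewrite /dot (bigD1 (inord k.+1)) //= big1 => [|i ik].
  by rewrite xk ?inordK // mul0r addr0.
by rewrite !mxE (negbTE ik) andbF mulr0.
Qed.

Lemma dotDl m (u v w : 'rV[R]_m) : dot (u + v) w = dot u w + dot v w.
Proof. by rewrite -[v]opprK dotBl -(scaleN1r (- v)) -(scaleN1r v) !dotZl; ring. Qed.

Lemma dotDr m (u v w : 'rV[R]_m) : dot u (v + w) = dot u v + dot u w.
Proof. by rewrite !(dotC u) dotDl. Qed.

Lemma dot_tilted k x y (a b : R) : (k < n)%N ->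
  in_coordinate_sphere k x -> in_coordinate_sphere k y ->
  dot (cos a *: val x + sin a *: val (pole k.+1))
      (cos b *: val y + sin b *: val (pole k.+1)) =
  cos a * cos b * dot x y + sin a * sin b.
Proof.
move=> kn xk yk; rewrite !(dotDl, dotDr, dotZl, dotZr) sphere_dot dot_pole //.
by rewrite (dotC (val (pole _))) dot_pole //; ring.
Qed.

Lemma val_tilt N k j x : (k < n)%N -> in_coordinate_sphere k x ->
  val (tilt N k j x) = cos (j%:R / N%:R * (pi / 2)) *: val x +
    sin (j%:R / N%:R * (pi / 2)) *: val (pole k.+1).
Proof.
move=> kn xk; rewrite val_insubd dot_tilted // sphere_dot mulr1 -!expr2 cos2Dsin2.
by rewrite eqxx.
Qed.

Lemma in_coordinate_sphere_tilt N k j x : (k < n)%N ->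
  in_coordinate_sphere k x -> in_coordinate_sphere k.+1 (tilt N k j x).
Proof.
move=> kn xk i ki; rewrite val_tilt // !mxE xk ?mulr0 1?ltnW // add0r.
rewrite (_ : i == _ = false) ?andbF ?mulr0 //; apply/eqP => ik.
by move: ki; rewrite ik inordK ?ltnn.
Qed.

(** For tilt angles [a], [b] the left side equals [1 - cos (a - b)] plus
    [cos a * cos b * (1 - dot x y)], and [a], [b] differ by at most one step. *)
Lemma dot_tilt_ge N k i j x y : (k < n)%N -> (0 < N)%N ->
  in_coordinate_sphere k x -> in_coordinate_sphere k y ->
  (i <= N)%N -> (j <= N)%N -> (i <= j.+1)%N -> (j <= i.+1)%N ->
  1 - dot (tilt N k i x) (tilt N k j y) <=
  (1 - cos (pi / 2 / N%:R)) + (1 - dot x y).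
Proof.
move=> kn N0 xk yk iN jN ij ji; rewrite !val_tilt // dot_tilted //.
have N0' : (0 : R) < N%:R by rewrite ltr0n.
have pi0 := @pi_gt0 R.
have cosI (m : nat) : (m <= N)%N -> 0 <= cos (m%:R / N%:R * (pi / 2) : R) <= 1.
  move=> mN; rewrite cos_le1 andbT; apply: cos_ge0_pihalf.
  have h0 : 0 <= m%:R / N%:R * (pi / 2) :> R by rewrite !mulr_ge0 ?invr_ge0 ?ler0n //; lra.
  have h1 : m%:R / N%:R * (pi / 2) <= pi / 2 :> R.
    by rewrite ger_pMl ?divr_gt0 // ler_pdivrMr // mul1r ler_nat.
  by lra.
have {cosI} := (cosI i iN, cosI j jN).
set a := i%:R / _ * _; set b := j%:R / _ * _ => -[/andP[ca0 ca1] /andP[cb0 cb1]].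
have cab : cos (pi / 2 / N%:R) <= cos (a - b).
  have [ij0|[ij1|ji1]] : (i = j \/ i = j.+1 \/ j = i.+1)%N by lia.
  - by rewrite /a /b ij0 subrr cos0 cos_le1.
  - by rewrite (_ : a - b = pi / 2 / N%:R) // /a /b ij1; field; rewrite gt_eqF.
  - rewrite -[leRHS]cosN (_ : - (a - b) = pi / 2 / N%:R) // /a /b ji1.
    by field; rewrite gt_eqF.
rewrite cosB in cab.
have d1 : 0 <= 1 - dot x y by have := sphere_dot_itv x y; lra.
have cc : cos a * cos b <= 1 by rewrite mulr_ile1.
have : cos a * cos b * (1 - dot x y) <= 1 - dot x y by rewrite ler_piMl.
by lra.
Qed.

(** The vertices of a prism simplex lie at two consecutive tilts, so each dimension adds one mesh
    step to the bound. *)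
Lemma hemisphere_fine N k s : (0 < N)%N -> (k <= n)%N ->
  s \in hemisphere (pole 0) (@sphere_opp R n) (tilt N) N k ->
  [/\ size s = k.+1, {in s, forall x, in_coordinate_sphere k x} &
    {in s &, forall x y, 1 - dot x y <= k%:R * (1 - cos (pi / 2 / N%:R))}].
Proof.
move=> N0; elim: k s => [|k IHk] t kn.
  rewrite /= inE => /eqP ->; split => // [x|x y]; rewrite !inE => /eqP ->.
    move=> i i0; rewrite mxE (_ : i == _ = false) ?andbF //; apply/eqP => ii.
    by move: i0; rewrite ii inordK.
  by move=> /eqP ->; rewrite sphere_dot subrr mul0r.
move=> /mem_hemisphereS[j [s [jN ts [r rh sr]]]].
have [sz xk xy] := IHk r (ltnW kn) rh.
have {}sz : size s = k.+1 by case: sr => ->; rewrite ?size_map.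
have {}xk : {in s, forall x, in_coordinate_sphere k x}.
  case: sr => -> // _ /mapP[x xr ->] i ki.
  by rewrite mxE (xk _ xr) // oppr0.
have {}xy : {in s &, forall x y, 1 - dot x y <= k%:R * (1 - cos (pi / 2 / N%:R))}.
  case: sr => -> // _ _ /mapP[x xr ->] /mapP[y yr ->].
  by rewrite dot_sphere_oppr dotC dot_sphere_oppr opprK dotC; exact: xy.
split=> [|y yt|y z yt zt]; first by rewrite (size_prism ts) sz.
  have [x xs [->|->]] := mem_prism ts yt.
    by apply: in_coordinate_sphere_tilt => //; exact: xk.
  by apply: in_coordinate_sphere_tilt => //; exact: xk.
have -> : k.+1%:R * (1 - cos (pi / 2 / N%:R)) = 1 - cos (pi / 2 / N%:R) +
   k%:R * (1 - cos (pi / 2 / N%:R)) :> R by ring.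
have [x xs xE] := mem_prism ts yt; have [x' xs' xE'] := mem_prism ts zt.
have jN' := ltnW jN; have := xy _ _ xs xs'; rewrite -(lerD2l (1 - cos (pi / 2 / N%:R))).
apply: le_trans; case: xE xE' => -> [] ->; apply: dot_tilt_ge => //; by [exact: xk|lia].
Qed.

Lemma cos_mesh_small (e : R) : 0 < e ->
  exists2 N, (0 < N)%N & 1 - cos (pi / 2 / N%:R) <= e.
Proof.
move=> e0; have := @continuous_cos R 0.
move=> /cvgrPdist_le /(_ e e0) /nbhs_ballP[d /= d0 hd].
have pi0 := @pi_gt0 R.
pose N := (Num.bound (pi / 2 / d)).+1; exists N => //.
have N0 : (0 : R) < N%:R by rewrite ltr0n.
have hN : pi / 2 / d < N%:R.
  apply: lt_trans (archi_boundP _) _; first by rewrite !divr_ge0 // ltW.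
  by rewrite ltr_nat.
have hb : ball (0 : R) d (pi / 2 / N%:R).
  rewrite -ball_normE /= sub0r normrN ger0_norm ?divr_ge0 ?(ltW pi0) //.
  by rewrite ltr_pdivrMr // [ltRHS]mulrC -ltr_pdivrMr.
have /= := hd _ hb; rewrite cos0; exact: le_trans (ler_norm _).
Qed.

End FineChains.

(** * The lower bound *)

Section LowerBound.
Local Open Scope classical_set_scope.
Context {R : realType}.
Local Notation label := (R *l bool)%type.

(* The label [(t, b)] stands for the point [e^{it}] of the circle if [b], and for its
   antipode otherwise. *)
Definition label_dist (p q : label) : R :=
  if p.2 == q.2 then `|p.1 - q.1| else pi - `|p.1 - q.1|.

(** Neighbours have opposite signs, so their [label_dist] is [pi] minus their gap; the parity of the
    length tells whether the ends agree in sign. *)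
Lemma alternating_path_spread (d : R) b (p : label) (L : seq label) :
  {in p :: L &, forall q r, label_dist q r <= d} ->
  path <=%O p L -> alternates b [seq q.2 | q <- p :: L] ->
  (size L)%:R * (pi - d) <= (last p L).1 - p.1 /\
  (last p L).2 = p.2 (+) odd (size L).
Proof.
elim: L p b => [|q L IHL] p b dL.
  by rewrite /= mul0r subrr addbF.
move=> /= /andP[pq qL] /and3P[/eqP pb /eqP qb altL].
have dL' : {in q :: L &, forall u v, label_dist u v <= d}.
  by move=> u v uL vL; apply: dL; rewrite inE ?uL ?vL orbT.
have [|h1 h2] := IHL q (~~ b) dL' qL; first by rewrite /= qb eqxx.
have := dL p q; rewrite !inE !eqxx orbT => /(_ isT isT).
rewrite /label_dist pb qb.
have -> : (b == ~~ b) = false by case: (b).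
move: pq; rewrite leEprodlexi => /andP[pq _].
rewrite distrC ger0_norm ?subr_ge0 // => h.
split; last by rewrite h2 ?qb ?pb; case: (b) (odd _) => -[].
have -> : (size L).+1%:R * (pi - d) = (size L)%:R * (pi - d) + (pi - d) by ring.
by lra.
Qed.

Lemma alternating_label_dist (d : R) b l (L : seq label) : size L = (2 * l).+1 ->
  {in L &, forall q r, label_dist q r <= d} -> label_alternates b L ->
  pi - pi / (2 * l).+1%:R <= d.
Proof.
move=> sL dL; rewrite /label_alternates.
have : sorted <=%O (sort <=%O L) by exact: sort_le_sorted.
have : {in sort <=%O L &, forall q r, label_dist q r <= d}.
  by move=> q r; rewrite !mem_sort; exact: dL.
rewrite -(size_sort <=%O) in sL.
case: (sort _ _) sL => // p M [sM] dM pM altM.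
have [h1 h2] := alternating_path_spread dM pM altM.
have := dM p (last p M); rewrite mem_head mem_last => /(_ isT isT).
rewrite /label_dist h2 sM oddM andFb addbF eqxx distrC.
move: h1; rewrite sM => h1 h3.
have {}h1 : (2 * l)%:R * (pi - d) <= d.
  by apply: le_trans h3; apply: le_trans (ler_norm _).
have m0 : (0 : R) < (2 * l).+1%:R by rewrite ltr0n.
have mK : (2 * l).+1%:R * (pi / (2 * l).+1%:R) = pi :> R by rewrite mulrC divfK ?gt_eqF.
rewrite -(ler_pM2l m0) mulrBr mK.
move: h1; rewrite -[(2 * l).+1%:R]natr1; lra.
Qed.

Definition signed n (b : bool) (x : sphere R n) := if b then x else sphere_opp x.

Lemma sphere_oppK n : involutive (@sphere_opp R n).
Proof. by move=> x; apply: val_inj; rewrite /= opprK. Qed.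

Lemma acos_dot_signed n (a b : bool) (x y : sphere R n) :
  acos (dot (signed a x) (signed b y)) =
  if a == b then acos (dot x y) else pi - acos (dot x y).
Proof.
have oppl (u v : sphere R n) : dot (sphere_opp u) v = - dot u v.
  by rewrite dotC dot_sphere_oppr dotC.
case: a b => -[]; rewrite /signed ?oppl ?dot_sphere_oppr ?opprK //.
  by rewrite acosN ?sphere_dot_itv.
by rewrite acosN ?sphere_dot_itv.
Qed.

Lemma circle_label (z : sphere R 1) : exists p : label,
  0 <= p.1 < pi /\ z = signed p.2 (circle p.1).
Proof.
have [u ->] := circle_onto z.
have cI : -1 <= cos u <= 1 by rewrite cos_geN1 cos_le1.
have [t tpi [ct st]] := unit_circle_angle (cos2Dsin2 u).
have pi0 := @pi_gt0 R.
have circE (v w : R) : cos v = cos w -> sin v = sin w -> circle v = circle w.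
  by move=> cE sE; apply: val_inj; exact: moment_curve_congr.
have oppE (v : R) : circle (v + pi) = sphere_opp (circle v).
  by apply: val_inj; exact: moment_curveDpi.
rewrite -(circE _ _ ct st).
have [t0|t0] := leP 0 t; last first.
  exists (t + pi, false); split=> /=; first by lra.
  by rewrite oppE sphere_oppK.
have [tp|tp] := ltP t pi; first by exists (t, true); rewrite /= t0.
exists (0, false); split => /=; first by lra.
by rewrite -oppE add0r (_ : t = pi) //; lra.
Qed.

(** The predicate depends only on the antipodal pair, so both of its points get the same choice. *)
Definition representative n (x : sphere R n) : sphere R n :=
  choose [pred y | (y == x) || (y == sphere_opp x)] x.

Lemma representativeP n (x : sphere R n) :
  x = signed (representative x == x) (representative x).
Proof.
have : [pred y | (y == x) || (y == sphere_opp x)] (representative x).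
  by apply: chooseP; rewrite /= eqxx.
rewrite /signed /= => /orP[/eqP ->|/eqP xE]; first by rewrite eqxx.
by case: ifP => [/eqP ->//|_]; rewrite xE sphere_oppK.
Qed.

Lemma sphere_opp_neq n (x : sphere R n) : (sphere_opp x == x) = false.
Proof.
apply/eqP => xE; have := acos_dot_opp x x; rewrite xE sphere_dot acos1.
by have := @pi_gt0 R; lra.
Qed.

Lemma representative_opp n (x : sphere R n) :
  representative (sphere_opp x) = representative x.
Proof.
rewrite /representative (@eq_choose _ _ [pred y | (y == x) || (y == sphere_opp x)]).
  by apply: choose_id; rewrite /= eqxx ?orbT.
by move=> y /=; rewrite sphere_oppK orbC.
Qed.

Lemma representative_opp_eq n (x : sphere R n) :
  (representative (sphere_opp x) == sphere_opp x) = ~~ (representative x == x).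
Proof.
rewrite representative_opp; have := representativeP x.
case: eqVneq => [-> _|_ /= xE]; first by rewrite eq_sym sphere_opp_neq.
by rewrite [X in sphere_opp X]xE sphere_oppK eqxx.
Qed.

Lemma distortion_lower_bound l n (r : set (sphere R 1 * sphere R n)) :
  (2 * l <= n)%N -> correspondence r ->
  ((pi - pi / (2 * l).+1%:R)%:E <= distortion r)%E.
Proof.
move=> ln [_ r2]; rewrite leNgt; apply/negP => rlt.
have pi0 := @pi_gt0 R.
have m0 : (0 : R) < (2 * l).+1%:R by rewrite ltr0n.
set d0 := pi - _ in rlt.
have d0pi : d0 < pi by rewrite /d0 ltrBlDr ltrDl divr_gt0.
have d00 : 0 <= d0.
  by rewrite subr_ge0 ler_pdivrMr // ler_peMr ?ler1n // ltW.
have ex x : exists z, r (z, x).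
  have : [set p.2 | p in r] x by rewrite r2.
  by move=> [[z y] /= rzy yx]; exists z; rewrite -yx.
have [d [dd0 dr]] : exists d, d < d0 /\ forall z x w y, r (z, x) -> r (w, y) ->
    `|acos (dot z w) - acos (dot x y)| <= d.
  have sub z x w y : r (z, x) -> r (w, y) ->
      ((`|acos (dot z w) - acos (dot x y)|)%:E <= distortion r)%E.
    move=> zx wy; apply: ereal_sup_ubound.
    by exists (z, x) => //; exists (w, y) => //; rewrite /= !sphere_mdistE.
  case: (distortion r) rlt sub => [d| |] //; rewrite ?lte_fin => dd sub.
    by exists d; split=> // z x w y zx wy; rewrite -lee_fin; exact: sub.
  (* A distortion of [-oo] contradicts [sub] for any related pairs. *)
  by exists (d0 - 1); split=> [|z x w y zx wy]; [lra|have := sub _ _ _ _ zx wy].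
have [f rf] := choice ex.
have [lab0 lab0P] := choice circle_label.
(* The label of an odd map: [f] is used on representatives only, and the sign is reversed at their
   antipodes. *)
pose lab (x : sphere R n) : label := ((lab0 (f (representative x))).1,
  (lab0 (f (representative x))).2 == (representative x == x)).
have labN x : lab (sphere_opp x) = flip (lab x).
  rewrite /lab /flip representative_opp_eq representative_opp /=.
  by case: (_.2) (_ == x) => -[].
have dist_circle s t : 0 <= s < pi -> 0 <= t < pi ->
    acos (dot (circle s) (circle t)) = `|s - t|.
  move=> sI tI; rewrite dot_moment_curve2 -cos_norm cosK // in_itv /= normr_ge0.
  by rewrite ler_norml; lra.
(* An antipode replaces a distance by [pi] minus it in both spaces, so the odd extension keeps the
   bound [d]. *)
have labP x y : label_dist (lab x) (lab y) <= acos (dot x y) + d.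
  have := dr _ _ _ _ (rf (representative x)) (rf (representative y)).
  rewrite [in X in _ -> _ <= acos X + _](representativeP x).
  rewrite [in X in _ -> _ <= acos X + _](representativeP y) acos_dot_signed.
  have [xI xE] := lab0P (f (representative x)).
  have [yI yE] := lab0P (f (representative y)).
  rewrite [in X in X -> _]xE [in X in X -> _]yE acos_dot_signed dist_circle //.
  rewrite /label_dist /lab /= ler_norml.
  by case: (lab0 _).2 (lab0 _).2 (_ == x) (_ == y) => [] [] [] [] /=; lra.
(* Half of the slack, so that [d + e] is still below [d0]. *)
pose e := (d0 - d) / 2.
have e0 : 0 < e by rewrite /e; lra.
have d_ge0 : 0 <= d.
  exact: le_trans (normr_ge0 _) (dr _ _ _ _ (rf (pole 0)) (rf (pole 0))).
have epi : e < pi by rewrite /e; lra.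
(* At most [n] mesh steps accumulate in a simplex, which keeps its vertices within distance [e]. *)
have ce0 : 0 < (1 - cos e) / n.+1%:R.
  rewrite divr_gt0 ?ltr0n // subr_gt0 -(@cos0 R) ltr_cos // in_itv /=; lra.
have [N N0 mesh] := cos_mesh_small ce0.
have fine k s : (k <= n)%N -> s \in hemisphere (pole 0) (@sphere_opp R n) (tilt N) N k ->
    {in [seq lab x | x <- s] &, forall p q, label_dist p q <= d + e}.
  move=> kn sh; have [_ _ xy] := hemisphere_fine N0 kn sh.
  move=> _ _ /mapP[x xs ->] /mapP[y ys ->].
  apply: le_trans (labP x y) _; rewrite addrC lerD2l.
  have xyI := sphere_dot_itv x y.
  rewrite leNgt; apply/negP => lt.
  have : cos (acos (dot x y)) < cos e.
    by rewrite ltr_cos // in_itv /= ?acos_ge0 ?acos_lepi //; lra.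
  rewrite acosK // => lt2.
  have := xy _ _ xs ys; set C := 1 - cos (pi / 2 / N%:R) in mesh *.
  have C0 : 0 <= C by rewrite subr_ge0 cos_le1.
  have : k%:R * C <= n.+1%:R * C by rewrite ler_wpM2r // ler_nat ltnW.
  have : n.+1%:R * C <= 1 - cos e by rewrite mulrC -ler_pdivlMr ?ltr0n.
  by lra.
have dlt : d + e < d0 by rewrite /e; lra.
have [|||||s sh [b alt_s]] := @fan _ R _ (pole 0) (@sphere_opp R n) (tilt N) N lab (2 * l).
- exact: sphere_oppK.
- by move=> k x; exact: tilt0.
- by move=> k; exists (pole k.+1) => x; exact: tilt_end.
- exact: labN.
(* Equal keys with opposite signs would be at [label_dist] equal to [pi], more than [d + e]. *)
- move=> k s kl sh p q ps qs pq.
  have := fine k s (leq_trans kl ln) sh p q ps qs.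
  rewrite /label_dist pq subrr normr0 subr0; case: eqP => // _.
  by lra.
have [sz _ _] := hemisphere_fine N0 ln sh.
have := alternating_label_dist _ (fine _ _ ln sh) alt_s; rewrite size_map => /(_ _ sz).
by rewrite -/d0; lra.
Qed.

End LowerBound.

(** * The Gromov-Hausdorff distances from the circle *)

Local Open Scope ereal_scope.

Lemma gromov_hausdorff_circle_sphere (R : realType) (l n : nat) :
  (1 <= l)%N -> (2 * l <= n <= (2 * l).+1)%N ->
  2%:E * gromov_hausdorff (sphere R 1) (sphere R n) =
  (pi - pi / (2 * l).+1%:R)%R%:E.
Proof.
move=> l1 /andP[ln nl]; rewrite /gromov_hausdorff muleA -EFinM divff // mul1e.
apply/eqP; rewrite eq_le; apply/andP; split.
  apply: ge_ereal_inf; exists (distortion (@max_relation R n)).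
    exists (@max_relation R n) => //; apply: max_relation_correspondence.
    by apply: leq_trans ln; rewrite muln_gt0.
  exact: distortion_max_relation.
apply: le_ereal_inf_tmp => _ [r rc <-]; exact: distortion_lower_bound.
Qed.

Theorem theorem1p1 (R : realType) (l : nat) (hl : (1 <= l)%N) :
  let d2l := 2%:E * gromov_hausdorff (sphere R 1) (sphere R (2 * l)%N) in
  let d2l1 := 2%:E * gromov_hausdorff (sphere R 1) (sphere R (2 * l + 1)%N) in
  (d2l = d2l1 /\ d2l1 = (2 * pi * l%:R / (2 * l + 1)%:R)%R%:E) /\
  (pi%:E - d2l = pi%:E - d2l1 /\ pi%:E - d2l1 = (pi / (2 * l + 1)%:R)%R%:E).
Proof.
move=> d2l d2l1.
have m0 : ((2 * l).+1%:R != 0 :> R)%R by rewrite pnatr_eq0.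
have -> : d2l = (pi - pi / (2 * l).+1%:R)%R%:E.
  by apply: gromov_hausdorff_circle_sphere; rewrite // leqnn leqnSn.
have -> : d2l1 = (pi - pi / (2 * l).+1%:R)%R%:E.
  by apply: gromov_hausdorff_circle_sphere; rewrite // addn1 leqnn leqnSn.
rewrite addn1 -EFinB subKr; split; split=> //; congr EFin.
by apply: (mulIf m0); rewrite mulrBl !divfK // -natr1 natrM; ring.
Qed.
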